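(* Let $X$ be a separable Banach space admitting a continuous Schauder frame $(x_t,f_t)_{t\in M}\subseteq X\times X^*$ over a $\sigma$-finite measure space $(M,\Sigma,\mu)$. Then the following are equivalent: (1) $(x_t,f_t)_{t\in M}$ is shrinking and boundedly complete; (2) $X$ does not contain a copy of $c_0$ or of $\ell_1$ (i.e. no closed subspace of $X$ is isomorphic to $c_0$ or to $\ell_1$); (3) $X$ is reflexive.
   Context: Pettis integral: for a $\sigma$-finite measure space $(M,\Sigma,\mu)$ and a separable Banach space $X$, a function $F:M\to X$ is Pettis integrable if for every $E\in\Sigma$ there is $x_E\in X$ with $f(x_E)=\int_E f(F)\,d\mu$ (Lebesgue integral) for all $f\in X^*$; then $\int_E F\,d\mu:=x_E$. Continuous Schauder frame: a measurable map $t\mapsto (x_t,f_t)\in X\times X^*$ on $M$, where $X$ is a separable Banach space, is a continuous Schauder frame of $X$ if for every $x\in X$ the function $t\mapsto f_t(x)x_t$ is Pettis integrable and $x=\int_M f_t(x)x_t\,d\mu(t)$. Directed set: $\mathcal D=\{E\in\Sigma:\mu(E)<\infty \text{ and } \sup_{t\in E}\|f_t\|\|x_t\|<\infty\}$, ordered by inclusion ($E\preceq F$ iff $E\subseteq F$). For $E\in\mathcal D$ and $x^{**}\in X^{**}$ the Pettis integral $\int_E x^{**}(f_t)x_t\,d\mu(t)$ exists as an element of $X$. Tail operator: for $E\in\Sigma$, $T_E:X\to X$ is the bounded operator $T_E(x)=\int_{M\setminus E}f_t(x)x_t\,d\mu(t)$, with adjoint $T_E^*:X^*\to X^*$. Shrinking: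 the continuous Schauder frame $(x_t,f_t)_{t\in M}$ is shrinking if $\lim_{E\in\mathcal D}\|T_E^*f\|=0$ for all $f\in X^*$. Boundedly complete: the continuous Schauder frame $(x_t,f_t)_{t\in M}$ is boundedly complete if for every $x^{**}\in X^{**}$ the net $\left(\int_E x^{**}(f_t)x_t\,d\mu(t)\right)_{E\in\mathcal D}$ converges in norm to an element of $X$. *)

(* Defs.v *)
From HB Require Import structures.
From mathcomp Require Import all_boot all_order all_algebra.
From mathcomp Require Import all_classical all_reals all_analysis.

Set Implicit Arguments.
Unset Strict Implicit.
Unset Printing Implicit Defensive.

Import Order.TTheory GRing.Theory Num.Theory.
Import numFieldNormedType.Exports.

Local Open Scope classical_set_scope.
Local Open Scope ring_scope.

(* Extended-real valued, so that it is meaningful (possibly +oo) even when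
   [g] is not known to be bounded. *)
Definition opnorm (R : realType) (X : normedModType R) (g : X -> R^o) :
    \bar R :=
  ereal_sup [set (`|g x|)%:E | x in [set x : X | `|x| <= 1]].

Section Dual.
Context {R : realType} (X : normedModType R).

Definition dual_pred : {pred X -> R^o} :=
  fun g => `[< linear g /\ continuous g >].

Record dual := Dual { dual_fun :> X -> R^o ; dualP : dual_fun \in dual_pred }.

HB.instance Definition _ := [isSub for dual_fun].
HB.instance Definition _ := [Choice of dual by <:].

Lemma dual_submod_closed : submod_closed dual_pred.
Proof.
split.
  apply/asboolP; split; first by move=> a x y /=; rewrite scaler0 addr0.
  exact: cst_continuous.
move=> a g h /asboolP[lg cg] /asboolP[lh ch]; apply/asboolP; split.
  move=> b x y; rewrite [LHS]/= !fctE lg lh /= !scalerDr !scalerA (mulrC a b).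
  by rewrite addrACA.
by move=> x; apply: cvgD; [apply: cvgZl_tmp; exact: cg|exact: ch].
Qed.

HB.instance Definition _ :=
  GRing.isSubmodClosed.Build _ _ dual_pred dual_submod_closed.
HB.instance Definition _ := [SubChoice_isSubLmodule of dual by <:].

Lemma dual_linear (g : dual) : linear g.
Proof. by have /asboolP[] := dualP g. Qed.

Lemma dual_continuous (g : dual) : continuous g.
Proof. by have /asboolP[] := dualP g. Qed.

HB.instance Definition _ (g : dual) :=
  GRing.isLinear.Build R X R^o *:%R (dual_fun g) (dual_linear g).

Lemma dual_bound (g : dual) : exists2 C : R, 0 <= C &
  forall x : X, `|g x| <= C * `|x|.
Proof.
have /linear_bounded_continuous/linear_boundedP := @dual_continuous g.
move=> /pinfty_ex_gt0[C C0 gC]; exists C => //; exact: ltW.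
Qed.

Lemma opnorm_ge0 (g : dual) : (0 <= opnorm g)%E.
Proof.
apply: ereal_sup_ubound; exists 0; first by rewrite /= normr0.
by rewrite linear0 normr0.
Qed.

Lemma opnorm_fin (g : dual) : opnorm g \is a fin_num.
Proof.
have [C C0 gC] := dual_bound g.
rewrite ge0_fin_numE; last exact: opnorm_ge0.
apply: (@le_lt_trans _ _ C%:E); last exact: ltry.
apply: ge_ereal_sup => _ [x /= x1 <-]; rewrite lee_fin.
by rewrite (le_trans (gC x))// ler_piMr.
Qed.

Definition dual_norm (g : dual) : R := fine (opnorm g).

Lemma dual_norm_le (g : dual) (C : R) :
  (forall x, `|x| <= 1 -> `|g x| <= C) -> dual_norm g <= C.
Proof.
move=> gC; rewrite -lee_fin /dual_norm fineK; last exact: opnorm_fin.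
by apply: ge_ereal_sup => _ [x /= x1 <-]; rewrite lee_fin gC.
Qed.

Lemma le_dual_norm1 (g : dual) (x : X) : `|x| <= 1 -> `|g x| <= dual_norm g.
Proof.
move=> x1; rewrite -lee_fin /dual_norm fineK; last exact: opnorm_fin.
by apply: ereal_sup_ubound; exists x.
Qed.

Lemma dual_norm_ge0 (g : dual) : 0 <= dual_norm g.
Proof. by rewrite fine_ge0// opnorm_ge0. Qed.

Lemma le_dual_norm (g : dual) (x : X) : `|g x| <= dual_norm g * `|x|.
Proof.
have [->|x0] := eqVneq x 0; first by rewrite linear0 !normr0 mulr0.
have xgt0 : 0 < `|x| by rewrite normr_gt0.
have: `|g (`|x|^-1 *: x)| <= dual_norm g.
  apply: le_dual_norm1.
  by rewrite normrZ normfV normr_id mulVf// gt_eqF.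
rewrite linearZ normrZ normfV normr_id mulrC.
by rewrite ler_pdivrMr.
Qed.

Lemma ler_dual_normD (g h : dual) : dual_norm (g + h) <= dual_norm g + dual_norm h.
Proof.
apply: dual_norm_le => x x1; rewrite (le_trans (ler_normD _ _))//.
by rewrite lerD// le_dual_norm1.
Qed.

Lemma dual_normZ_le (a : R) (g : dual) : dual_norm (a *: g) <= `|a| * dual_norm g.
Proof.
apply: dual_norm_le => x x1; rewrite /= [`|_|]normrZ.
by rewrite ler_wpM2l// le_dual_norm1.
Qed.

Lemma dual_normZ (a : R) (g : dual) : dual_norm (a *: g) = `|a| * dual_norm g.
Proof.
apply/eqP; rewrite eq_le dual_normZ_le /=.
have [->|a0] := eqVneq a 0; first by rewrite normr0 mul0r dual_norm_ge0.
have := dual_normZ_le a^-1 (a *: g).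
by rewrite scalerA mulVf// scale1r normfV ler_pdivlMl ?normr_gt0.
Qed.

Lemma dual_norm_eq0 (g : dual) : dual_norm g = 0 -> g = 0.
Proof.
move=> g0; apply/val_inj/funext => x; apply/eqP.
by rewrite -normr_le0 (le_trans (le_dual_norm g x))// g0 mul0r.
Qed.

HB.instance Definition _ := Lmodule_isNormed.Build R dual
  ler_dual_normD dual_normZ dual_norm_eq0.

End Dual.

Section Reflexive.
Context {R : realType} (X : normedModType R).

Lemma eval_dual (x : X) :
  (fun g : dual X => g x : R^o) \in @dual_pred R (dual X).
Proof.
apply/asboolP.
have le : linear (fun g : dual X => g x : R^o) by [].
split=> //.
pose e := HB.pack_for {linear dual X -> R^o} (fun g : dual X => g x : R^o)
  (GRing.isLinear.Build _ _ _ _ _ le).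
suff : continuous e by [].
apply/linear_bounded_continuous/linear_boundedP.
near=> r => g /=; rewrite (le_trans (le_dual_norm g x))// mulrC.
apply: ler_wpM2r; first exact: dual_norm_ge0.
by near: r; apply: nbhs_pinfty_ge; rewrite num_real.
Unshelve. all: by end_near. Qed.

Definition bidual_embedding (x : X) : dual (dual X) := Dual (eval_dual x).

Definition reflexive_space : Prop := range bidual_embedding = setT.

End Reflexive.

Definition separable_space (T : topologicalType) : Prop :=
  exists S : set T, countable S /\ dense S.

Section C0.
Context (R : realType).

Definition c0_pred : {pred nat -> R^o} := fun u => `[< u @ \oo --> (0 : R^o) >].

Record c0 := C0 { c0_seq :> nat -> R^o ; c0P : c0_seq \in c0_pred }.

HB.instance Definition _ := [isSub for c0_seq].
HB.instance Definition _ := [Choice of c0 by <:].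

Lemma c0_submod_closed : submod_closed c0_pred.
Proof.
split; first by apply/asboolP; exact: cvg_cst.
move=> a u v /asboolP u0 /asboolP v0; apply/asboolP.
rewrite -[X in _ --> X]addr0 -{1}(scaler0 _ a).
apply: cvgD; last exact: v0.
by apply: cvgZl_tmp; exact: u0.
Qed.

HB.instance Definition _ :=
  GRing.isSubmodClosed.Build _ _ c0_pred c0_submod_closed.
HB.instance Definition _ := [SubChoice_isSubLmodule of c0 by <:].

Definition c0_norm (u : c0) : R := sup (range (fun n => `|u n|)).

Lemma c0_has_sup (u : c0) : has_sup (range (fun n => `|u n|)).
Proof.
split; first by exists `|u 0%N|, 0%N.
have /asboolP u0 := c0P u.
have /cvg_seq_bounded : cvg (u @ \oo) by apply/cvg_ex; exists 0.
move=> /pinfty_ex_gt0[C _ uC]; exists C => _ [n _ <-].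
exact: uC.
Qed.

Lemma le_c0_norm (u : c0) n : `|u n| <= c0_norm u.
Proof. by apply: (sup_upper_bound (c0_has_sup u)); exists n. Qed.

Lemma c0_norm_le (u : c0) C : (forall n, `|u n| <= C) -> c0_norm u <= C.
Proof.
move=> uC; apply: ge_sup; first by have [] := c0_has_sup u.
by apply/ubP => _ [n _ <-].
Qed.

Lemma ler_c0_normD (u v : c0) : c0_norm (u + v) <= c0_norm u + c0_norm v.
Proof.
apply: c0_norm_le => n; rewrite (le_trans (ler_normD _ _))//.
by rewrite lerD// le_c0_norm.
Qed.

Lemma c0_normZ_le a (u : c0) : c0_norm (a *: u) <= `|a| * c0_norm u.
Proof.
apply: c0_norm_le => n; rewrite [`|_|]normrZ.
by rewrite ler_wpM2l// le_c0_norm.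
Qed.

Lemma c0_normZ a (u : c0) : c0_norm (a *: u) = `|a| * c0_norm u.
Proof.
apply/eqP; rewrite eq_le c0_normZ_le /=.
have [->|a0] := eqVneq a 0.
  by rewrite normr0 mul0r (le_trans _ (le_c0_norm _ 0))//.
have := c0_normZ_le a^-1 (a *: u).
by rewrite scalerA mulVf// scale1r normfV ler_pdivlMl ?normr_gt0.
Qed.

Lemma c0_norm_eq0 (u : c0) : c0_norm u = 0 -> u = 0.
Proof.
move=> u0; apply/val_inj/funext => n; apply/eqP.
by rewrite -normr_le0 -u0 le_c0_norm.
Qed.

HB.instance Definition _ := Lmodule_isNormed.Build R c0
  ler_c0_normD c0_normZ c0_norm_eq0.

End C0.

Section L1.
Context (R : realType).

Definition l1_pred : {pred nat -> R^o} :=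
  fun u => `[< cvgn (series (fun n => `|u n|)) >].

Record l1 := L1 { l1_seq :> nat -> R^o ; l1P : l1_seq \in l1_pred }.

HB.instance Definition _ := [isSub for l1_seq].
HB.instance Definition _ := [Choice of l1 by <:].

Lemma cvg_l1Z a (u : nat -> R^o) : cvgn (series (fun n => `|u n|)) ->
  (series (fun n => `|a *: u n|)) @ \oo -->
    `|a| * limn (series (fun n => `|u n|)).
Proof.
move=> cu.
have -> : series (fun n => `|a *: u n|) =
          (fun n => `|a| * series (fun n => `|u n|) n).
  apply/funext => n; rewrite /series /= mulr_sumr.
  by apply: eq_bigr => i _; rewrite normrZ.
by apply: cvgMl_tmp.
Qed.

Lemma cvg_l1D (u v : nat -> R^o) :
  cvgn (series (fun n => `|u n|)) -> cvgn (series (fun n => `|v n|)) ->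
  cvgn (series (fun n => `|u n + v n|)).
Proof.
move=> cu cv; apply: (@series_le_cvg _ _ (fun n => `|u n| + `|v n|)).
- by move=> n /=; exact: normr_ge0.
- by move=> n /=; rewrite addr_ge0.
- by move=> n; exact: ler_normD.
- have -> : series (fun n => `|u n| + `|v n|) =
    series (fun n => `|u n|) \+ series (fun n => `|v n|).
    by apply/funext => n; rewrite /series /= big_split.
  exact: is_cvgD.
Qed.

Lemma l1_submod_closed : submod_closed l1_pred.
Proof.
split.
  apply/asboolP; have -> : series (fun n => `|(0 : nat -> R^o) n|) = cst 0.
    by apply/funext => n; rewrite /series /= big1// => i _; rewrite normr0.
  exact: is_cvg_cst.
move=> a u v /asboolP cu /asboolP cv; apply/asboolP.
apply: (@cvg_l1D (a *: u) v) => //.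
by apply/cvg_ex; eexists; exact: cvg_l1Z.
Qed.

HB.instance Definition _ :=
  GRing.isSubmodClosed.Build _ _ l1_pred l1_submod_closed.
HB.instance Definition _ := [SubChoice_isSubLmodule of l1 by <:].

Definition l1_norm (u : l1) : R := limn (series (fun n => `|u n|)).

Lemma l1_cvg (u : l1) : cvgn (series (fun n => `|u n|)).
Proof. by have /asboolP := l1P u. Qed.

Lemma ler_l1_normD (u v : l1) : l1_norm (u + v) <= l1_norm u + l1_norm v.
Proof.
rewrite /l1_norm -limD; [|exact: l1_cvg..].
apply: ler_lim; [exact: l1_cvg|by apply: is_cvgD; exact: l1_cvg|].
apply: nearW => n; rewrite fctE /series /= -big_split /=.
by apply: ler_sum => i _; exact: ler_normD.
Qed.

Lemma l1_normZ a (u : l1) : l1_norm (a *: u) = `|a| * l1_norm u.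
Proof. by apply: cvg_lim => //; apply: cvg_l1Z; exact: l1_cvg. Qed.

Lemma l1_norm_eq0 (u : l1) : l1_norm u = 0 -> u = 0.
Proof.
move=> u0; apply/val_inj/funext => n; apply/eqP; rewrite -normr_le0 -u0.
apply: (@le_trans _ _ (series (fun n => `|u n|) n.+1)).
  by rewrite /series /= big_nat_recr//= lerDr sumr_ge0.
apply: nondecreasing_cvgn_le; last exact: l1_cvg.
by apply/nondecreasing_seqP => k; rewrite /series /= big_nat_recr//= lerDl.
Qed.

HB.instance Definition _ := Lmodule_isNormed.Build R l1
  ler_l1_normD l1_normZ l1_norm_eq0.

End L1.

(* A linear homeomorphism T (with inverse S) from Y onto a closed subspace,
   the range of T, of X. *)
Definition contains_copy (R : realType) (X Y : normedModType R) : Prop :=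
  exists (T : {linear Y -> X}) (S : X -> Y),
    [/\ closed (range T), continuous T, cancel T S &
        {within range T, continuous S}].

Section Pettis.
Context {R : realType} {X : normedModType R} d {M : measurableType d}.
Variable mu : {measure set M -> \bar R}.
Implicit Types (E : set M) (F : M -> X).

Definition is_pettis_integral E F (y : X) : Prop :=
  forall g : dual X,
    mu.-integrable E (fun t => (g (F t))%:E) /\
    (g y)%:E = (\int[mu]_(t in E) (g (F t))%:E)%E.

Definition pettis_integrable F : Prop :=
  forall E, measurable E -> exists y, is_pettis_integral E F y.

(* The value is unique when it exists, as [dual X] separates points; it is the
   junk value 0 when it does not exist. *)
Definition pettis_integral E F : X := xget 0 [set y | is_pettis_integral E F y].

End Pettis.

Section Frame.
Context {R : realType} {X : normedModType R} d {M : measurableType d}.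
Variables (mu : {measure set M -> \bar R}) (x : M -> X) (f : M -> dual X).

(* The sigma-algebra on X * X^* is the Borel one, for the norm topologies. *)
Definition continuous_schauder_frame : Prop :=
  measurable_fun [set: M]
    (fun t => (x t, f t) : g_sigma_algebraType (@open (X * dual X)%type)) /\
  forall y : X, pettis_integrable mu (fun t => f t y *: x t) /\
    y = pettis_integral mu [set: M] (fun t => f t y *: x t).

Definition frame_dir : set (set M) :=
  [set E | [/\ measurable E, (mu E < +oo)%E &
    has_ubound [set `|f t| * `|x t| | t in E]]].

(* The filter of tails of the directed set [frame_dir] ordered by inclusion:
   convergence along it is convergence of nets indexed by [frame_dir]. *)
Definition frame_net : set_system (set M) :=
  filter_from frame_dir (fun E0 => [set E | frame_dir E /\ E0 `<=` E]).

Lemma frame_dir0 : frame_dir set0.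
Proof.
split; [exact: measurable0|by rewrite measure0|].
by exists 0 => _ [t []].
Qed.

Lemma frame_dirU E F : frame_dir E -> frame_dir F -> frame_dir (E `|` F).
Proof.
move=> [mE fE [C EC]] [mF fF [D FD]]; split.
- exact: measurableU.
- by rewrite (le_lt_trans (measureU2 mu mE mF))// lte_add_pinfty.
- exists (Num.max C D) => _ [t [Et|Ft] <-]; rewrite le_max.
    by rewrite EC//; exists t.
  by rewrite FD ?orbT//; exists t.
Qed.

#[global] Instance frame_net_filter : ProperFilter frame_net.
Proof.
apply: filter_from_proper; last by move=> E dE; exists E; split.
apply: filter_from_filter; first by exists set0; exact: frame_dir0.
move=> E F dE dF; exists (E `|` F); first exact: frame_dirU.
by move=> G [dG]; rewrite subUset => -[EG FG]; split; split.
Qed.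

Definition tail_operator (E : set M) (y : X) : X :=
  pettis_integral mu (~` E) (fun t => f t y *: x t).

(* Kept as a bare function on X: that it is bounded, for a continuous Schauder
   frame, is a theorem (uniform boundedness), and its norm is [opnorm]. *)
Definition tail_adjoint (E : set M) (g : dual X) : X -> R^o :=
  g \o tail_operator E.

Definition shrinking : Prop :=
  forall g : dual X,
    opnorm (tail_adjoint E g) @[E --> frame_net] --> (0 : \bar R)%E.

Definition boundedly_complete : Prop :=
  forall phi : dual (dual X),
    cvg (pettis_integral mu E (fun t => phi (f t) *: x t) @[E --> frame_net]).

End Frame.

(* Main.v *)
Require Import Defs.
From HB Require Import structures.
From mathcomp Require Import all_boot all_order all_algebra.
From mathcomp Require Import all_classical all_reals all_analysis.
From mathcomp Require Import measurable_realfun ring lra.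

Set Implicit Arguments.
Unset Strict Implicit.
Unset Printing Implicit Defensive.

Import Order.TTheory GRing.Theory Num.Theory.
Import numFieldNormedType.Exports.

Local Open Scope classical_set_scope.
Local Open Scope ring_scope.

(** A continuous Schauder frame is unconditional: for a functional [g] the
    coefficient functions [t |-> f_t(y) g(x_t)] are integrable, with
    L1-norm at most [C_g |y|] by uniform boundedness.

    If the frame is not shrinking, a gliding hump gives disjoint sets [F_n] and
    [y_n] in the unit ball with [\int_(F_n) |f_t(y_n) g(x_t)| >= e]; Rosenthal's
    disjointness lemma extracts a subsequence which is separated by the seminorms
    [\int_(F_n) |f_t(.) g(x_t)|], hence equivalent to the basis of l1. If the
    frame is shrinking and the net of some [phi] in the bidual is not Cauchy, the
    increments [\int_(F_n) phi(f_t) x_t] form a weakly unconditionally Cauchy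
    sequence bounded away from 0, and the same lemma, applied to their norming
    functionals, yields a copy of c0.

    As the values of [f] need not be essentially separable, the identity
    [\int_E phi(f_t) g(x_t) = phi(P_E^* g)] is not immediate. The operators [P_E]
    being compact for suitable [E], [P_E^{**} phi] lies in [X]; shrinkingness makes
    these points a bounded sequence converging weak-star to [phi], and
    dominated convergence concludes. Together with the two net conditions this
    identity represents [phi] by a point, so [X] is reflexive. Finally c0 and l1
    do not embed in a reflexive space: look at an ultrafilter limit of the images
    of [e_0 + ... + e_(n-1)], respectively of [e_n]. *)

(** * Sublinear functionals and the Mazur-Orlicz form of the Hahn-Banach theorem *)

Section MazurOrlicz.
Context {R : realType} {X : lmodType R}.
Implicit Types (p q : X -> R) (D : set (X * R)).

Definition sublinear p : Prop :=
  (forall x y, p (x + y) <= p x + p y) /\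
  (forall t x, 0 < t -> p (t *: x) <= t * p x).

(** A pair [(z, r)] in [D] encodes the constraint [r <= g z] on the functional [g] to be found. *)
Definition convex_cone D : Prop :=
  [/\ D (0, 0), forall z w r s, D (z, r) -> D (w, s) -> D (z + w, r + s) &
      forall t z r, 0 < t -> D (z, r) -> D (t *: z, t * r)].

Lemma sublinear0 p : sublinear p -> p 0 = 0.
Proof.
move=> [pD pZ]; apply/eqP; rewrite eq_le.
have := pZ 2^-1 0; have := pZ 2 0; rewrite !scaler0 invr_gt0 => h1 h2.
by have := h1 ltac:(lra); have := h2 ltac:(lra); lra.
Qed.

Lemma sublinearN p x : sublinear p -> - p (- x) <= p x.
Proof.
by move=> sp; have := sp.1 x (- x); rewrite subrr sublinear0//; lra.
Qed.

(* The infimal convolution of [p] with the cone [D]. *)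
Lemma sublinear_inf p D : sublinear p -> convex_cone D ->
  (forall z r, D (z, r) -> r <= p z) ->
  exists q, [/\ sublinear q, forall x, q x <= p x &
    forall z r x, D (z, r) -> q x <= p (x + z) - r].
Proof.
move=> sp [D0 DD DZ] Dp.
pose V x := [set p (x + zr.1) - zr.2 | zr in D].
have Vlb x : has_inf (V x).
  split; first by exists (p (x + 0) - 0), (0, 0).
  exists (- p (- x)) => _ [[z r] Dzr <-] /=.
  have := sp.1 (x + z) (- x); rewrite addrAC subrr add0r.
  by have := Dp _ _ Dzr; lra.
pose q x := inf (V x).
have qle z r x : D (z, r) -> q x <= p (x + z) - r.
  by move=> Dzr; apply: ge_inf; [exact: (Vlb x).2|exists (z, r)].
have le_q c x : (forall z r, D (z, r) -> c <= p (x + z) - r) -> c <= q x.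
  move=> h; apply: lb_le_inf; first exact: (Vlb x).1.
  by move=> _ [[z r] Dzr <-] /=; exact: h.
exists q; split => //; last first.
  by move=> x; have := qle 0 0 x D0; rewrite addr0 subr0.
split=> [x y|t x t0].
  rewrite -lerBlDr; apply: (le_q) => z r Dzr.
  rewrite lerBlDl -lerBlDr; apply: (le_q _ y) => w s Dws.
  have := qle _ _ (x + y) (DD _ _ _ _ Dzr Dws); have := sp.1 (x + z) (y + w).
  by rewrite addrACA; lra.
have tN0 : t != 0 by rewrite gt_eqF.
rewrite -ler_pdivrMl//; apply: (le_q) => z r Dzr; rewrite ler_pdivrMl//.
apply: (le_trans (qle _ _ _ (DZ _ _ _ t0 Dzr))).
by rewrite -scalerDr mulrBr lerB// sp.2.
Qed.

(** Zorn's lemma for the reversed pointwise order. The pointwise infimum of a chain is finite, each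
    member being at least [- p (- x)] at [x], and it is subadditive because two members of a chain
    are comparable. *)
Lemma minimal_sublinear p : sublinear p ->
  exists q, [/\ sublinear q, forall x, q x <= p x &
    forall q', sublinear q' -> (forall x, q' x <= q x) -> q' = q].
Proof.
move=> sp.
pose T := {q : X -> R | sublinear q /\ forall x, q x <= p x}.
pose Rel (q q' : T) := `[< forall x, sval q' x <= sval q x >].
have spp : sublinear p /\ forall x, p x <= p x by split.
have [|||A Atot|[q [sq qp]] qmin] := @Zorn T Rel.
- by move=> t; apply/asboolP.
- move=> r s t /asboolP rs /asboolP st; apply/asboolP => x.
  exact: le_trans (st x) (rs x).
- move=> [s ps] [t pt] /asboolP/= st /asboolP/= ts; apply/eq_exist/funext => x.
  by apply/eqP; rewrite eq_le st ts.
- have [[a0 Aa0]|/forallNP A0] := pselect (exists a, A a); last first.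
    by exists (exist _ p spp) => s /A0.
  pose V x := [set sval a x | a in A].
  have Vlb x : has_inf (V x).
    split; first by exists (sval a0 x), a0.
    exists (- p (- x)) => _ [[a [sa ap]] Aa <-] /=.
    by apply: le_trans (sublinearN _ sa); rewrite lerN2.
  pose m x := inf (V x).
  have mle a x : A a -> m x <= sval a x.
    by move=> Aa; apply: ge_inf; [exact: (Vlb x).2|exists a].
  have lem c x : (forall a, A a -> c <= sval a x) -> c <= m x.
    move=> h; apply: lb_le_inf; first exact: (Vlb x).1.
    by move=> _ [a Aa <-]; exact: h.
  have sm : sublinear m.
    split=> [x y|t x t0].
      rewrite -lerBlDr; apply: (lem) => a Aa.
      rewrite lerBlDl -lerBlDr; apply: (lem _ y) => b Ab; rewrite lerBlDr.
      have [/asboolP ab|/asboolP ba] := Atot _ _ Aa Ab.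
        apply: (le_trans (mle b _ Ab)); apply: (le_trans ((svalP b).1.1 _ _)).
        by rewrite addrC lerD2l ab.
      apply: (le_trans (mle a _ Aa)); apply: (le_trans ((svalP a).1.1 _ _)).
      by rewrite addrC lerD2r ba.
    rewrite -ler_pdivrMl//; apply: (lem) => a Aa; rewrite ler_pdivrMl//.
    by apply: (le_trans (mle a _ Aa)); exact: (svalP a).1.2.
  have mp x : m x <= p x.
    by apply: (le_trans (mle _ _ Aa0)); exact: (svalP a0).2.
  exists (exist _ m (conj sm mp)) => s As; apply/asboolP => x /=; exact: mle.
- exists q; split => // q' sq' q'q.
  have q'p x : q' x <= p x by exact: le_trans (q'q x) (qp x).
  by have /(_ (asboolT q'q))/(congr1 sval) := qmin (exist _ q' (conj sq' q'p)).
Qed.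

(** Convolving [q] with the ray through [(y, q y)] gives a sublinear function below [q], hence [q]
    itself by minimality. The constraint then reads [q x <= q (x + y) - q y], so [q] is additive. *)
Lemma minimal_sublinear_linear q : sublinear q ->
  (forall q', sublinear q' -> (forall x, q' x <= q x) -> q' = q) ->
  linear (q : X -> R^o).
Proof.
move=> sq qmin.
have qD x y : q (x + y) = q x + q y.
  apply/eqP; rewrite eq_le sq.1 /=.
  pose D := [set zr | exists2 t, 0 <= t & zr = (t *: y, t * q y)].
  have [||q' [sq' q'q q'D]] := @sublinear_inf q D sq.
  - split; first by exists 0 => //; rewrite scale0r mul0r.
      move=> z w r s [t t0 [-> ->]] [u u0 [-> ->]]; exists (t + u).
        exact: addr_ge0.
      by rewrite scalerDl mulrDl.
    move=> t z r t0 [u u0 [-> ->]]; exists (t * u); first by rewrite mulr_ge0// ltW.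
    by rewrite scalerA mulrA.
  - move=> z r [t t0 [-> ->]].
    move: t0; rewrite le_eqVlt => /predU1P[<-|t0].
      by rewrite scale0r mul0r sublinear0.
    have := sq.2 t^-1 (t *: y).
    rewrite invr_gt0 scalerA mulVf ?gt_eqF// scale1r => /(_ t0).
    by rewrite ler_pdivlMl.
  rewrite -(qmin _ sq' q'q) -lerBrDr.
  rewrite {1}(qmin _ sq' q'q) (qmin _ sq' q'q) -{1}(qmin _ sq' q'q).
  by apply: q'D; exists 1; rewrite ?ler01// scale1r mul1r.
have qN x : q (- x) = - q x.
  by apply/eqP; rewrite -addr_eq0 -qD addNr sublinear0.
have qZ t x : 0 < t -> q (t *: x) = t * q x.
  move=> t0; apply/eqP; rewrite eq_le sq.2//=.
  have := sq.2 t^-1 (t *: x).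
  rewrite invr_gt0 scalerA mulVf ?gt_eqF// scale1r => /(_ t0).
  by rewrite ler_pdivlMl.
move=> a x y; rewrite qD; congr (_ + _).
have [a0|a0|->] := ltgtP a 0; last by rewrite !scale0r sublinear0.
- rewrite -[a]opprK scaleNr qN qZ ?oppr_gt0//.
  by rewrite -scaleNr.
- exact: qZ.
Qed.

End MazurOrlicz.

Lemma dual_of_bounded {R : realType} {X : normedModType R} (h : X -> R)
    (C : R) : linear (h : X -> R^o) -> (forall x, `|h x| <= C * `|x|) ->
  exists g : dual X, forall x, g x = h x.
Proof.
move=> lh hC.
pose e := HB.pack_for {linear X -> R^o} (h : X -> R^o)
  (GRing.isLinear.Build _ _ _ _ _ lh).
have ce : continuous e.
  apply/linear_bounded_continuous/linear_boundedP.
  exists C; rewrite num_real; split=> // r /ltW Cr x.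
  by rewrite (le_trans (hC x))// ler_wpM2r.
have eP : (h : X -> R^o) \in @dual_pred R X by apply/asboolP; split.
by exists (Dual eP).
Qed.

(** A minimal sublinear function below the infimal convolution of [C * |x|] with [D] is linear. Its
    value at [- z] is at most [C * |- z + z| - r = - r], which is the required lower bound at
    [z]. *)
Lemma mazur_orlicz {R : realType} {X : normedModType R} (C : R)
    (D : set (X * R)) : 0 <= C -> convex_cone D ->
  (forall z r, D (z, r) -> r <= C * `|z|) ->
  exists g : dual X, (forall x, `|g x| <= C * `|x|) /\
    (forall z r, D (z, r) -> r <= g z).
Proof.
move=> C0 cD Dp.
have sp : sublinear (fun x : X => C * `|x|).
  split=> [x y|t x t0]; first by rewrite -mulrDr ler_wpM2l// ler_normD.
  by rewrite normrZ gtr0_norm// mulrCA.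
have [p' [sp' p'p p'D]] := sublinear_inf sp cD Dp.
have [q [sq qp' qmin]] := minimal_sublinear sp'.
have lq := minimal_sublinear_linear sq qmin.
have qN x : q (- x) = - q x.
  by have := lq (-1) x 0; rewrite !addr0 (sublinear0 sq) addr0 !scaleN1r.
have qC x : q x <= C * `|x| by exact: le_trans (qp' x) (p'p x).
have qb x : `|q x| <= C * `|x|.
  by rewrite ler_norml qC lerNl -qN (le_trans (qC _))// normrN.
have [g gq] := dual_of_bounded lq qb.
exists g; split=> [x|z r Dzr]; rewrite gq//.
rewrite -lerN2 -qN (le_trans (qp' _))// (le_trans (p'D _ _ _ Dzr))//.
by rewrite addNr normr0 mulr0 sub0r.
Qed.

(** * Norming functionals, separation from a closed range, and extension *)

Section HahnBanach.
Context {R : realType} {X : normedModType R}.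

Lemma norming_functional (y : X) :
  exists g : dual X, (forall x, `|g x| <= `|x|) /\ g y = `|y|.
Proof.
pose D := [set zr : X * R | exists2 t, 0 <= t & zr = (t *: y, t * `|y|)].
have [||g [g1 gD]] := @mazur_orlicz R X 1 D ler01.
- split; first by exists 0 => //; rewrite scale0r mul0r.
    move=> z w r s [t t0 [-> ->]] [u u0 [-> ->]]; exists (t + u).
      exact: addr_ge0.
    by rewrite scalerDl mulrDl.
  move=> t z r t0 [u u0 [-> ->]]; exists (t * u); first by rewrite mulr_ge0// ltW.
  by rewrite scalerA mulrA.
- by move=> z r [t t0 [-> ->]]; rewrite mul1r normrZ ger0_norm.
exists g; split=> [x|]; first by rewrite -[leRHS]mul1r g1.
apply/eqP; rewrite eq_le; apply/andP; split.
  by rewrite (le_trans (ler_norm _))// -[leRHS]mul1r g1.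
by apply: gD; exists 1; rewrite ?ler01// scale1r mul1r.
Qed.

Lemma dual_norm_leP (g : dual X) (C : R) : 0 <= C ->
  (forall x, `|g x| <= C * `|x|) -> `|g| <= C.
Proof.
move=> C0 gC; apply: dual_norm_le => x x1.
by rewrite (le_trans (gC x))// ler_piMr.
Qed.

Lemma dual_apply_le (g : dual X) (x : X) : `|g x| <= `|g| * `|x|.
Proof. exact: le_dual_norm. Qed.

Lemma norm_le_dual (y : X) (C : R) : 0 <= C ->
  (forall g : dual X, `|g y| <= C * `|g|) -> `|y| <= C.
Proof.
move=> C0 yC; have [g [g1 gy]] := norming_functional y.
rewrite -gy (le_trans (ler_norm _))// (le_trans (yC g))//.
have g11 : `|g| <= 1 by apply: dual_norm_leP => // x; rewrite mul1r.
by rewrite ler_piMr.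
Qed.

(** The constraints ask [g] to be at least [t * e] at [t *: y + T a], where the ball of radius [e]
    around [y] misses the range; homogeneity makes them compatible with norm 1. For [t = 0] they
    make [g] nonnegative on a subspace, hence zero there. *)
Lemma separation_closed_range (Y : lmodType R) (T : {linear Y -> X}) (y : X) :
  closed (range T) -> ~ range T y ->
  exists2 g : dual X, (forall a, g (T a) = 0) & g y != 0.
Proof.
move=> cT yT.
have /nbhs_ballP[e /= e0 ye] : nbhs y (~` range T).
  by apply: open_nbhs_nbhs; split => //; rewrite openC.
have far a : e <= `|y + T a|.
  rewrite leNgt; apply/negP => h; apply: (ye (T (- a))); last by exists (- a).
  by rewrite -ball_normE /= linearN opprK.
pose D := [set zr : X * R | exists t a, 0 <= t /\ zr = (t *: y + T a, t * e)].
have [||g [g1 gD]] := @mazur_orlicz R X 1 D ler01.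
- split.
  + by exists 0, 0; rewrite linear0 scale0r mul0r addr0.
  + move=> z w r s [t [a [t0 [-> ->]]]] [u [b [u0 [-> ->]]]].
    exists (t + u), (a + b); rewrite addr_ge0//; split => //.
    by rewrite linearD scalerDl mulrDl addrACA.
  + move=> t z r t0 [u [a [u0 [-> ->]]]]; exists (t * u), (t *: a).
    rewrite mulr_ge0// 1?ltW//; split => //.
    by rewrite linearZ scalerDr scalerA mulrA.
- move=> z r [t [a [t0 [-> ->]]]]; rewrite mul1r.
  move: t0; rewrite le_eqVlt => /predU1P[<-|t0]; first by rewrite mul0r.
  rewrite -[T a](scalerKV (lt0r_neq0 t0)) -scalerDr normrZ gtr0_norm//.
  by rewrite ler_pM2l// -linearZ far.
exists g => [a|]; last first.
  rewrite gt_eqF// (lt_le_trans e0)//; apply: gD.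
  by exists 1, 0; rewrite ler01 scale1r linear0 addr0 mul1r.
have gT b : 0 <= g (T b).
  by apply: gD; exists 0, b; rewrite lexx scale0r add0r mul0r.
by apply/eqP; rewrite eq_le gT -oppr_ge0 -linearN -linearN gT.
Qed.

(** The cone is the graph of [h] over [T]; being stable under negation, it turns the lower bounds
    into equalities. *)
Lemma hahn_banach_extension (Y : lmodType R) (T : {linear Y -> X}) (C : R)
    (h : {linear Y -> R^o}) : 0 <= C -> (forall a, h a <= C * `|T a|) ->
  exists g : dual X, forall a, g (T a) = h a.
Proof.
move=> C0 hT.
pose D := [set zr : X * R | exists a, zr = (T a, h a : R)].
have [||g [gC gD]] := @mazur_orlicz R X C D C0.
- split.
  + by exists 0; rewrite !linear0.
  + by move=> z w r s [a [-> ->]] [b [-> ->]]; exists (a + b); rewrite !linearD.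
  + by move=> t z r t0 [a [-> ->]]; exists (t *: a); rewrite !linearZ.
- by move=> z r [a [-> ->]].
exists g => a; apply/eqP; rewrite eq_le gD ?andbT; last by exists a.
rewrite -lerN2 -!linearN; apply: gD; by exists (- a).
Qed.

End HahnBanach.

(** * Completeness of the dual, of c0 and of l1 by coordinatewise limits *)

Section Completeness.
Context {R : realType} {Y : normedModType R}.
Variables (F : set_system Y) (FF : ProperFilter F) (Fc : cauchy F).

Lemma cauchy_center (e : R) : 0 < e -> exists h, \forall g \near F, `|g - h| <= e.
Proof.
move=> e0; have /cauchyP/(_ e e0)[h Fh] := Fc; exists h.
by apply: filterS Fh => g; rewrite -ball_normE /= distrC => /ltW.
Qed.

Lemma cauchy_coordinate (c : Y -> R) (K : R) : 0 <= K ->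
  (forall g h, `|c g - c h| <= K * `|g - h|) -> cvg (c g @[g --> F]).
Proof.
move=> K0 cK; apply: cauchy_cvg; apply/cauchyP => e e0.
have K1 : 0 < K + 1 by rewrite ltr_wpDl.
have /cauchyP/(_ (e / (K + 1)) (divr_gt0 e0 K1))[h Fh] := Fc.
exists (c h).
suff : F [set g | `|c h - c g| < e].
  by rewrite -ball_normE.
apply: filterS Fh => g; rewrite -ball_normE /= => hg.
rewrite (le_lt_trans (cK _ _))// (@le_lt_trans _ _ ((K + 1) * `|h - g|))//.
  by rewrite ler_wpM2r// lerDl.
by rewrite -ltr_pdivlMl// mulrC.
Qed.

(** The hypothesis says that closed balls are closed for the coordinatewise limit [y]. Applied to a
    ball of radius [e / 3] that eventually contains the filter, it upgrades coordinatewise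
    convergence to norm convergence. *)
Lemma cauchy_cvg_lsc (y : Y) :
  (forall h e, (\forall g \near F, `|g - h| <= e) -> `|y - h| <= e) -> F --> y.
Proof.
move=> yP; apply/cvgrPdist_lt => e e0.
have [|h Fh] := @cauchy_center (e / 3); first by rewrite divr_gt0.
have yh := yP _ _ Fh; apply: filterS Fh => g gh.
by rewrite (le_lt_trans (ler_distD h _ _))// (distrC h); lra.
Qed.

End Completeness.

Lemma cvg_le_bound {R : realType} {T : Type} {F : set_system T}
    {FF : ProperFilter F} (f : T -> R) (l c : R) :
  f @ F --> l -> (\forall t \near F, f t <= c) -> l <= c.
Proof.
move=> fl fc; rewrite -(cvg_lim _ fl)//; apply: limr_le => //.
by apply/cvg_ex; exists l.
Qed.

Lemma cvg_dist_le {R : realType} {T : Type} {F : set_system T}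
    {FF : ProperFilter F} (f : T -> R) (l a e : R) :
  f @ F --> l -> (\forall t \near F, `|f t - a| <= e) -> `|l - a| <= e.
Proof.
move=> fl; apply: cvg_le_bound; apply: cvg_norm; apply: cvgB => //.
exact: cvg_cst.
Qed.

Section DualComplete.
Context {R : realType} {X : normedModType R}.

Lemma dual_cauchy_cvg (F : set_system (dual X)) :
  ProperFilter F -> cauchy F -> cvg F.
Proof.
move=> FF Fc.
have cx (x : X) : cvg (g x @[g --> F]).
  apply: (@cauchy_coordinate _ _ _ FF Fc (fun g : dual X => g x) `|x|) => // g h.
  by rewrite mulrC (le_trans _ (dual_apply_le _ _)).
pose l (x : X) : R := lim (g x @[g --> F]).
have lh (h : dual X) e : (\forall g \near F, `|g - h| <= e) ->
    forall x, `|l x - h x| <= e * `|x|.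
  move=> Fh x; apply: (cvg_dist_le (cx x)).
  by apply: filterS Fh => g gh; rewrite (le_trans (dual_apply_le (g - h) x))// ler_wpM2r.
have [h /lh lh1] := cauchy_center FF Fc ltr01.
have ll : linear (l : X -> R^o).
  move=> a x y; apply: cvg_lim => //.
  have E (g : dual X) : g (a *: x + y) = a *: (g x : R^o) + g y by rewrite linearP.
  rewrite (eq_cvg _ _ E).
  by apply: cvgD; [apply: cvgZl_tmp; exact: cx|exact: cx].
have [x|g gl] := @dual_of_bounded R X l (1 + `|h|) ll.
  rewrite -(subrK (h x) (l x)) (le_trans (ler_normD _ _))// mulrDl lerD//.
  exact: dual_apply_le.
apply/cvg_ex; exists g; apply: cauchy_cvg_lsc => // k e /[dup] /filter_ex[m mk] /lh kl.
apply: dual_norm_leP => [|x]; first exact: le_trans mk.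
by have := kl x; rewrite -gl.
Qed.
End DualComplete.

HB.instance Definition _ (R : realType) (X : normedModType R) :=
  Uniform_isComplete.Build (dual X) (@dual_cauchy_cvg R X).

Section SequenceSpacesComplete.
Context {R : realType}.

Lemma c0_apply_le (u : c0 R) n : `|u n| <= `|u|.
Proof. exact: le_c0_norm. Qed.

Lemma c0_cauchy_cvg (F : set_system (c0 R)) :
  ProperFilter F -> cauchy F -> cvg F.
Proof.
move=> FF Fc.
have cx n : cvg ((u : c0 R) n @[u --> F]).
  apply: (@cauchy_coordinate _ _ _ FF Fc (fun u : c0 R => u n) 1) => // g h.
  by rewrite mul1r; exact: (c0_apply_le (g - h)).
pose l n : R := lim ((u : c0 R) n @[u --> F]).
have lh (h : c0 R) e : (\forall g \near F, `|g - h| <= e) ->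
    forall n, `|l n - h n| <= e.
  move=> Fh n; apply: (cvg_dist_le (cx n)).
  by apply: filterS Fh => g gh; rewrite (le_trans (c0_apply_le (g - h) n)).
have l0 : (l : nat -> R^o) \in @c0_pred R.
  apply/asboolP/cvgrPdist_le => e e0; rewrite /= in e0 *.
  have e2 : 0 < e / 2 by rewrite divr_gt0.
  have [h /lh lh1] := cauchy_center FF Fc e2.
  have /asboolP/cvgrPdist_le/(_ _ e2) := c0P h.
  apply: filterS => n /=; rewrite !sub0r !normrN => hn.
  rewrite -(subrK (h n) (l n)) (le_trans (ler_normD _ _))//.
  by rewrite (splitr e) lerD.
apply/cvg_ex; exists (C0 l0); apply: cauchy_cvg_lsc => // k e /lh kl.
exact: (@c0_norm_le _ (C0 l0 - k)).
Qed.

Lemma l1_partial_le (u : l1 R) n : \sum_(k < n) `|u k| <= `|u|.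
Proof.
have -> : \sum_(k < n) `|u k| = series (fun n => `|u n|) n by rewrite /series /= big_mkord.
apply: nondecreasing_cvgn_le; last exact: l1_cvg.
by apply/nondecreasing_seqP => k; rewrite /series /= big_nat_recr//= lerDl.
Qed.

Lemma l1_norm_leP (u : l1 R) C : (forall n, \sum_(k < n) `|u k| <= C) -> `|u| <= C.
Proof.
move=> uC; apply: limr_le; first exact: l1_cvg.
by apply: nearW => n; rewrite /series /= big_mkord.
Qed.

Lemma l1_apply_le (u : l1 R) n : `|u n| <= `|u|.
Proof.
by apply: le_trans (l1_partial_le u n.+1); rewrite big_ord_recr/= lerDr sumr_ge0.
Qed.

Lemma l1_mem (u : nat -> R) C : (forall n, \sum_(k < n) `|u k| <= C) ->
  (u : nat -> R^o) \in @l1_pred R.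
Proof.
move=> uC; apply/asboolP/nondecreasing_is_cvgn.
  by apply/nondecreasing_seqP => k; rewrite /series /= big_nat_recr//= lerDl.
by exists C => _ [n _ <-]; rewrite /series /= big_mkord.
Qed.

Lemma l1_cauchy_cvg (F : set_system (l1 R)) :
  ProperFilter F -> cauchy F -> cvg F.
Proof.
move=> FF Fc.
have cx n : cvg ((u : l1 R) n @[u --> F]).
  apply: (@cauchy_coordinate _ _ _ FF Fc (fun u : l1 R => u n) 1) => // g h.
  by rewrite mul1r; exact: (l1_apply_le (g - h)).
pose l n : R := lim ((u : l1 R) n @[u --> F]).
have lh (h : l1 R) e : (\forall g \near F, `|g - h| <= e) ->
    forall n, \sum_(k < n) `|l k - h k| <= e.
  move=> Fh n.
  apply: (@cvg_le_bound _ _ F _ (fun g : l1 R => \sum_(k < n) `|g k - h k|)).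
    apply: cvg_big => [|i _]; first exact: (@add_continuous R).
    apply: cvg_norm; apply: cvgB; first exact: cx.
    exact: cvg_cst.
  by apply: filterS Fh => g gh; rewrite (le_trans (l1_partial_le (g - h) n)).
have [h /lh lh1] := cauchy_center FF Fc ltr01.
have ll : (l : nat -> R^o) \in @l1_pred R.
  apply: (@l1_mem l (1 + `|h|)) => n.
  apply: le_trans (lerD (lh1 n) (l1_partial_le h n)).
  rewrite -big_split /=; apply: ler_sum => i _.
  by rewrite -{1}(subrK (h i) (l i)) ler_normD.
apply/cvg_ex; exists (L1 ll); apply: cauchy_cvg_lsc => // k e /lh kl.
exact: l1_norm_leP.
Qed.

End SequenceSpacesComplete.

HB.instance Definition _ (R : realType) :=
  Uniform_isComplete.Build (c0 R) (@c0_cauchy_cvg R).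

HB.instance Definition _ (R : realType) :=
  Uniform_isComplete.Build (l1 R) (@l1_cauchy_cvg R).

(** * Uniform boundedness in the dual and for weakly bounded families *)

Section UniformBoundedness.
Context {R : realType}.

Lemma dual_uniform_bounded (X : completeNormedModType R) (I : Type)
    (G : I -> dual X) : (forall y, exists C, forall i, `|G i y| <= C) ->
  exists2 K, 0 <= K & forall i, `|G i| <= K.
Proof.
move=> GC; pose S : set (X -> R^o) := range (fun i => G i : X -> R^o).
have [||K KP] := @Banach_Steinhauss R X R^o S _ _ 1.
- move=> _ [i _ <-]; split; last exact: dual_linear.
  move=> r; exists (`|G i| * r) => x xr.
  by rewrite (le_trans (dual_apply_le _ _))// ler_wpM2l.
- by move=> y; have [C yC] := GC y; exists C => _ [i _ <-].
exists (Num.max K 0) => [|i]; first by rewrite le_max lexx orbT.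
apply: dual_norm_le => x x1; rewrite le_max KP//; by exists i.
Qed.

(** Uniform boundedness is applied to the evaluations at [y i], on the dual, which is complete even
    when [X] is not; Hahn-Banach recovers the norm of [y i]. *)
Lemma weakly_bounded_bounded (X : normedModType R) (I : Type) (y : I -> X) :
  (forall g : dual X, exists C, forall i, `|g (y i)| <= C) ->
  exists2 K, 0 <= K & forall i, `|y i| <= K.
Proof.
move=> yC; have [|K K0 KP] := @dual_uniform_bounded (dual X) I
  (fun i => bidual_embedding (y i)); first by move=> g; exact: yC.
exists K => // i; apply: norm_le_dual => // g.
by have := dual_apply_le (bidual_embedding (y i)) g; move/le_trans; apply; rewrite ler_wpM2r.
Qed.

End UniformBoundedness.

(** * Extraction of nearly diagonal submatrices *)

Section Rosenthal.
Context {R : realType}.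
Implicit Types (a : nat -> nat -> R) (s : nat -> nat).

Let offdiag_seq s (j N : nat) := [seq s k | k <- iota 0 N & k != j].

Let offdiag_sum a s j N l :
  \sum_(k < N | k != j :> nat) a l (s k) = \sum_(k <- offdiag_seq s j N) a l k.
Proof.
by rewrite big_map big_filter -(big_mkord (fun k => k != j) (fun k => a l (s k)))
  /index_iota subn0.
Qed.

Let offdiag_uniq s j N : injective s -> uniq (offdiag_seq s j N).
Proof. by move=> si; rewrite map_inj_uniq// filter_uniq// iota_uniq. Qed.

(* Rosenthal's disjointness lemma. Split the indices into infinitely many
   infinite classes: either one of them works, or picking in each class an
   index whose off-diagonal sum exceeds [e] lowers the row sums by [e]. *)
Lemma rosenthal_disjointness a (K e : R) : 0 < e ->
  (forall n k, 0 <= a n k) ->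
  (forall n (r : seq nat), uniq r -> \sum_(k <- r) a n k <= K) ->
  exists2 s, injective s &
    forall j N, \sum_(k < N | k != j :> nat) a (s j) (s k) <= e.
Proof.
move=> e0 a0 aK.
(* Row sums are measured in multiples of [e], so that the induction runs on the number of
   multiples. *)
have [m Km] : exists m, K <= m%:R * e.
  exists (Num.truncn (K / e)).+1; rewrite -ler_pdivrMr//.
  exact/ltW/truncnS_gt.
have {Km aK} : forall n (r : seq nat), uniq r -> \sum_(k <- r) a n k <= m%:R * e.
  by move=> n r us; rewrite (le_trans _ Km)// aK.
elim: m a a0 => [|m IH] a a0 aK.
  exists id => // j N; rewrite (offdiag_sum a id).
  by rewrite (le_trans (aK _ _ (offdiag_uniq _ _ _)))// mul0r ltW.
pose pr (p i : nat) := pickle (p, i).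
have pr_inj p i q j : pr p i = pr q j -> p = q /\ i = j.
  by move=> /(pcan_inj pickleK)[-> ->].
have pri p : injective (pr p) by move=> i j /pr_inj[].
have [[p pe]|/forallNP nopr] := pselect (exists p, forall j N,
    \sum_(k < N | k != j :> nat) a (pr p j) (pr p k) <= e).
  by exists (pr p).
have /choice[iN iNP] p : exists iN : nat * nat,
    e < \sum_(k < iN.2 | k != iN.1 :> nat) a (pr p iN.1) (pr p k).
  have /existsNP[i /existsNP[N /negP]] := nopr p.
  by rewrite -ltNge => eN; exists (i, N).
pose k p := pr p (iN p).1.
have ki : injective k by move=> p q /pr_inj[].
have [||s si sP] := IH (fun p q => a (k p) (k q)).
- by move=> p q; exact: a0.
- move=> p r us; have := iNP p; rewrite (offdiag_sum a (pr p)) -/(k p) => ep.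
  have := aK (k p) (map k r ++ offdiag_seq (pr p) (iN p).1 (iN p).2).
  rewrite big_cat/= big_map cat_uniq offdiag_uniq// map_inj_uniq// us andbT /=.
  (* The off-diagonal columns of class [p] avoid all chosen indices: [k p] is the excluded diagonal
     one, and the others lie in other classes. Their mass exceeds [e], so at most [m * e] remains
     for the chosen columns. *)
  have -> : ~~ has (mem (map k r)) (offdiag_seq (pr p) (iN p).1 (iN p).2).
    apply/hasPn => x /mapP[i]; rewrite mem_filter => /andP[ip _] ->.
    apply/negP => /mapP[q _ /pr_inj[pq iq]].
    by move: ip; rewrite iq pq eqxx.
  move=> /(_ isT).
  by rewrite -[m.+1]addn1 natrD mulrDl mul1r; lra.
- exists (k \o s) => [|j N]; first exact: inj_comp.
  exact: sP.
Qed.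

End Rosenthal.

(** * Criteria for containing a copy of a sequence space, and of l1 *)

Section Copies.
Context {R : realType} {X : completeNormedModType R}.

(** The lower bound makes the inverse Lipschitz on the range, and completeness of [Y] then makes the
    range closed. *)
Lemma contains_copy_bounded_below (Y : completeNormedModType R)
    (T : {linear Y -> X}) (C c : R) : 0 < c ->
  (forall a, `|T a| <= C * `|a|) -> (forall a, c * `|a| <= `|T a|) ->
  contains_copy X Y.
Proof.
move=> c0 TC Tc.
have dist a b : `|a - b| <= c^-1 * `|T a - T b|.
  by rewrite ler_pdivlMl// -linearB Tc.
have Ti : injective T.
  move=> a b ab; apply/eqP; rewrite -subr_eq0 -normr_le0.
  by rewrite (le_trans (dist _ _))// ab subrr normr0 mulr0.
have Tcont : continuous T.
  apply/linear_bounded_continuous/linear_boundedP.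
  exists C; rewrite num_real; split=> // r /ltW Cr a.
  by rewrite (le_trans (TC a))// ler_wpM2r.
(* Off the range [S] takes the default value 0; only its values on the range matter. *)
pose S x := xget 0 [set a | T a = x].
have TK : cancel T S.
  by move=> a; apply: Ti; apply: (@xgetPex _ 0 [set b | T b = T a]); exists a.
exists T, S; split => //.
- move=> y yT.
  (* The neighbourhoods of the closure point [y] are pulled back to [Y]; the lower bound makes this
     filter Cauchy, and its limit is a preimage of [y]. *)
  pose F : set_system Y := filter_from (nbhs y) (fun B => T @^-1` B).
  have FF : ProperFilter F.
    apply: filter_from_proper.
      apply: filter_from_filter; first by exists setT; exact: filterT.
      by move=> A B yA yB; exists (A `&` B) => //; exact: filterI.
    by move=> B yB; have [_ [[a _ <-] Ba]] := yT _ yB; exists a.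
  have TF : T @ F --> y by move=> B yB; exists B.
  have : cvg F.
    apply: cauchy_cvg; apply/cauchyP => e e0.
    have ce : 0 < c * e / 2 by rewrite divr_gt0// mulr_gt0.
    have /cvgrPdist_lt/(_ _ ce) yF := TF.
    have [a ya] := filter_ex yF.
    exists a; apply: filterS yF => b yb; rewrite -ball_normE /=.
    rewrite (le_lt_trans (dist _ _))// ltr_pdivrMl//.
    by rewrite (le_lt_trans (ler_distD y _ _))// (distrC (T a)); lra.
  move=> /cvg_ex[a Fa]; exists a => //.
  apply: (@cvg_unique _ (@norm_hausdorff _ X) (T @ F)) => //.
  exact: (cvg_comp _ _ Fa (Tcont a)).
- apply/subspace_continuousP => _ [a _ <-]; apply/cvgrPdist_lt => e e0.
  have ce : 0 < c * e by rewrite mulr_gt0.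
  have := nbhsx_ballx (T a) (c * e) ce; rewrite -ball_normE.
  apply: filterS => x /[swap] -[b _ <-] /= ab; rewrite /from_subspace !TK.
  by rewrite (le_lt_trans (dist _ _))// ltr_pdivrMl.
Qed.

(** Common to c0 and l1, with [u] the coordinates and [z] the images of the unit vectors. The lower
    estimate is asked for eventual bounds [l] of the partial sums; it passes to the sum since the
    partial sums are eventually at most the norm of the sum plus any [e]. *)
Lemma contains_copy_series (Y : completeNormedModType R) (u : Y -> nat -> R)
    (z : nat -> X) (C c : R) : 0 < c ->
  (forall k a b n, u (k *: a + b) n = k * u a n + u b n) ->
  (forall a, cvgn (series (fun n => u a n *: z n))) ->
  (forall a n, `|\sum_(i < n) u a i *: z i| <= C * `|a|) ->
  (forall a l, (\forall n \near \oo, `|\sum_(i < n) u a i *: z i| <= l) ->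
    c * `|a| <= l) ->
  contains_copy X Y.
Proof.
move=> c0 ulin ucvg uC uc.
pose S a := series (fun n => u a n *: z n).
have SE a n : S a n = \sum_(i < n) u a i *: z i by rewrite /S /series /= big_mkord.
pose T a : X := limn (S a).
have ST a : S a @ \oo --> T a by exact: ucvg.
have Tl : linear T.
  move=> k a b; apply: cvg_lim => //.
  have -> : S (k *: a + b) = (fun n => k *: S a n + S b n).
    apply/funext => n; rewrite !SE scaler_sumr -big_split /=.
    by apply: eq_bigr => i _; rewrite ulin scalerDl scalerA.
  by apply: cvgD => //; exact: cvgZl_tmp.
pose L := HB.pack_for {linear Y -> X} T (GRing.isLinear.Build _ _ _ _ _ Tl).
apply: (@contains_copy_bounded_below Y L C c c0) => a.
- apply: (@cvg_le_bound _ _ \oo _ (fun n => `|S a n|)); first exact: cvg_norm.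
  by apply: nearW => n; rewrite SE.
- apply/ler_addgt0Pr => e e0; apply: uc.
  have /cvgrPdist_le/(_ _ e0) := ST a; apply: filterS => n Sn.
  rewrite -SE -(subrK (L a) (S a n)) (le_trans (ler_normD _ _))// addrC.
  by rewrite lerD2l distrC.
Qed.

Lemma cvg_l1_series (a : l1 R) (z : nat -> X) (B : R) : (forall n, `|z n| <= B) ->
  cvgn (series (fun n => a n *: z n)).
Proof.
move=> zB; apply: normed_cvg.
apply: (@series_le_cvg _ _ (fun n => `|a n| * B)) => [n|n|n|].
- exact: normr_ge0.
- by rewrite mulr_ge0// (le_trans _ (zB 0%N)).
- by rewrite /= normrZ ler_wpM2l.
- have -> : series (fun n => `|a n| * B) = (fun n => series (fun n => `|a n|) n * B).
    by apply/funext => n; rewrite /series /= mulr_suml.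
  by apply: is_cvgMl; exact: l1_cvg.
Qed.

Lemma contains_l1 (z : nat -> X) (B c : R) : 0 < c -> (forall n, `|z n| <= B) ->
  (forall (a : nat -> R) n, c * \sum_(i < n) `|a i| <= `|\sum_(i < n) a i *: z i|) ->
  contains_copy X (l1 R).
Proof.
move=> c0 zB zc; have B0 : 0 <= B by rewrite (le_trans _ (zB 0%N)).
apply: (@contains_copy_series _ (fun a : l1 R => a) z B c c0) => //.
- by move=> a; exact: cvg_l1_series zB.
- move=> a n; rewrite (le_trans (ler_norm_sum _ _ _))//.
  rewrite (@le_trans _ _ (\sum_(i < n) B * `|a i|))//; last first.
    by rewrite -mulr_sumr ler_wpM2l// l1_partial_le.
  by apply: ler_sum => i _; rewrite normrZ mulrC ler_wpM2r.
- move=> a l al; rewrite -ler_pdivlMl//; apply: l1_norm_leP => m.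
  rewrite ler_pdivlMl//.
  have [n [mn nl]] := filter_ex (filterI (nbhs_infty_ge m) al).
  apply: le_trans nl; apply: le_trans (zc a n); rewrite ler_pM2l//.
  rewrite -(subnKC mn) big_split_ord /= lerDl; exact: sumr_ge0.
Qed.

(** Rosenthal's lemma for the matrix [q k (y n)] leaves diagonal entries at least [e] and
    off-diagonal row sums at most [e / 2]. Summing the seminorms of [v = \sum a i *: y (s i)] gives
    [e / 2 * \sum |a i| <= C * |v|], the lower l1 estimate. *)
Lemma contains_l1_of_seminorms (q : nat -> X -> R) (y : nat -> X) (C e : R) :
  0 < e ->
  (forall k u v, q k (u + v) <= q k u + q k v) ->
  (forall k t u, q k (t *: u) = `|t| * q k u) ->
  (forall u (r : seq nat), uniq r -> \sum_(k <- r) q k u <= C * `|u|) ->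
  (forall n, `|y n| <= 1) -> (forall n, e <= q n (y n)) ->
  contains_copy X (l1 R).
Proof.
move=> e0 qD qZ qC y1 qe.
have q0 k u : 0 <= q k u.
  have := qD k u (- u); have := qZ k 0 u; have := qZ k (-1) u.
  by rewrite scale0r normr0 mul0r subrr scaleN1r normrN normr1 mul1r => -> ->; lra.
have C0 : 0 < C.
  have := qC (y 0%N) [:: 0%N] isT; rewrite big_seq1 => h.
  rewrite ltNge; apply/negP => C0.
  have := qe 0%N; have : C * `|y 0%N| <= 0 by rewrite mulr_le0_ge0.
  lra.
have e2 : 0 < e / 2 by rewrite divr_gt0.
have [||s si sP] := @rosenthal_disjointness _ (fun n k => q k (y n)) C _ e2.
- by [].
- by move=> n r ur; rewrite (le_trans (qC _ _ ur))// ler_piMr// ltW.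
have qsum k n (a : nat -> R) (P : pred 'I_n) :
    q k (\sum_(i < n | P i) a i *: y (s i)) <= \sum_(i < n | P i) `|a i| * q k (y (s i)).
  elim/big_ind2 : _ => [|u b v c ub vc|i _]; last by rewrite qZ.
    by have := qZ k 0 0; rewrite scale0r normr0 mul0r => ->.
  by rewrite (le_trans (qD _ _ _))// lerD.
apply: (@contains_l1 (y \o s) 1 (e / 2 / C)) => [|n|a n]; first by rewrite divr_gt0.
  exact: y1.
rewrite mulrAC ler_pdivrMr// mulrC [leRHS]mulrC.
pose v := \sum_(i < n) a i *: y (s i); rewrite -/v.
have vC : \sum_(k < n) q (s k) v <= C * `|v|.
  have := qC v (map s (iota 0 n)); rewrite map_inj_uniq// iota_uniq => /(_ isT).
  by rewrite big_map -(big_mkord xpredT (fun k => q (s k) v)) /index_iota subn0.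
apply: le_trans vC.
have low (k : 'I_n) : `|a k| * e - \sum_(i < n | i != k) `|a i| * q (s k) (y (s i))
    <= q (s k) v.
  rewrite lerBlDr; apply: (@le_trans _ _ (`|a k| * q (s k) (y (s k)))).
    by rewrite ler_wpM2l.
  rewrite -qZ; apply: (@le_trans _ _ (q (s k) v + q (s k) (- (v - a k *: y (s k))))).
    apply: le_trans (qD _ _ _); rewrite opprB addrCA subrr addr0 lexx//.
  rewrite lerD2l -scaleN1r qZ normrN normr1 mul1r.
  by rewrite /v (bigD1 k)//= [X in q _ (X - _)]addrC addrK; exact: qsum.
apply: le_trans (ler_sum _ (fun k _ => low k)).
rewrite sumrB -mulr_suml.
suff : \sum_(k < n) \sum_(i < n | i != k) `|a i| * q (s k) (y (s i)) <=
    (\sum_(i < n) `|a i|) * (e / 2) by lra.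
(* After the exchange the inner sum runs over the seminorms for a fixed vector [y (s i)], which is
   the row sum controlled by [sP]. *)
rewrite (exchange_big_dep xpredT)//= mulr_suml; apply: ler_sum => i _.
rewrite -mulr_sumr ler_wpM2l//.
rewrite (le_trans _ (sP i n))// le_eqVlt; apply/orP; left; apply/eqP.
by apply: eq_bigl => k; rewrite eq_sym.
Qed.
End Copies.

(** * Weakly unconditionally Cauchy sequences and copies of c0 *)

Section WeaklyUnconditionallyCauchy.
Context {R : realType}.

Definition wuc (X : normedModType R) (y : nat -> X) : Prop :=
  forall g : dual X, exists C, forall r : seq nat, uniq r ->
    \sum_(k <- r) `|g (y k)| <= C.

Lemma wuc_comp (X : normedModType R) (y : nat -> X) (s : nat -> nat) :
  injective s -> wuc y -> wuc (y \o s).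
Proof.
move=> si yC g; have [C gC] := yC g; exists C => r ur.
by rewrite -(big_map s xpredT (fun k => `|g (y k)|)) gC// map_inj_uniq.
Qed.

(** The finite sums with coefficients in [-1, 1] form a weakly bounded family, hence a norm bounded
    one; the general case follows by scaling. *)
Lemma wuc_bound (X : normedModType R) (y : nat -> X) : wuc y ->
  exists2 K, 0 <= K & forall (r : seq nat) (c : nat -> R) m, uniq r ->
    (forall k, `|c k| <= m) -> `|\sum_(k <- r) c k *: y k| <= K * m.
Proof.
move=> yC.
pose I := {rc : seq nat * (nat -> R) | uniq rc.1 /\ forall k, `|rc.2 k| <= 1}.
have [g|K K0 KP] := @weakly_bounded_bounded R X I
    (fun i => \sum_(k <- (sval i).1) (sval i).2 k *: y k).
  have [C gC] := yC g; exists C => -[[r c] [/= ur c1]].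
  rewrite linear_sum (le_trans (ler_norm_sum _ _ _))// (le_trans _ (gC r ur))//.
  by apply: ler_sum => k _; rewrite linearZ normrM ler_piMl.
exists K => // r c m ur cm.
have : 0 <= m by rewrite (le_trans _ (cm 0%N)).
rewrite le_eqVlt => /predU1P[m0|m0].
  rewrite big1 ?normr0 -?m0 ?mulr0// => k _.
  by have := cm k; rewrite -m0 normr_le0 => /eqP ->; rewrite scale0r.
have c1 k : `|c k / m| <= 1.
  by rewrite normrM normfV (gtr0_norm m0) ler_pdivrMr// mul1r.
have -> : \sum_(k <- r) c k *: y k = m *: \sum_(k <- r) (c k / m) *: y k.
  rewrite scaler_sumr; apply: eq_bigr => k _.
  by rewrite scalerA mulrCA divff ?gt_eqF// mulr1.
rewrite normrZ gtr0_norm// mulrC ler_pM2r//.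
exact: (KP (exist _ (r, fun k => c k / m) (conj ur c1))).
Qed.

Lemma cvg_c0_series (X : completeNormedModType R) (z : nat -> X) (a : c0 R) :
  wuc z -> cvgn (series (fun n => a n *: z n)).
Proof.
move=> /wuc_bound[K K0 zK]; apply: cauchy_cvg; apply/cauchy_seriesP => e e0.
have K1 : 0 < K + 1 by rewrite ltr_wpDl.
have /asboolP/cvgrPdist_le/(_ (e / (K + 1)) (divr_gt0 e0 K1))[N _ aN] := c0P a.
exists ([set k | (N <= k)%N], setT).
  by split; [exact: nbhs_infty_ge|exact: filterT].
move=> [n m] [/= Nn _].
(* The bound [zK] asks for a bound on all coefficients, so those before [N] are replaced by 0. *)
have -> : \sum_(n <= k < m) a k *: z k =
    \sum_(n <= k < m) (if (N <= k)%N then a k else 0) *: z k.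
  by apply: eq_big_nat => k /andP[nk _]; rewrite (leq_trans Nn nk).
apply: (@le_lt_trans _ _ (K * (e / (K + 1)))); last first.
  by rewrite mulrCA gtr_pMr// ltr_pdivrMr// mul1r ltrDl.
apply: zK => [|k]; first exact: iota_uniq.
case: ifPn => [Nk|_]; last by rewrite normr0 ltW// divr_gt0.
by have := aN k Nk; rewrite sub0r normrN.
Qed.

(** Rosenthal's lemma is applied to [|g n (y k)|], with [g n] norming [y n]; inserting signs bounds
    the row sums through [wuc_bound]. Testing a partial sum with [g (s j)] isolates the term
    [a j * |y (s j)|] up to an error [e / 2 * |a|]. *)
Lemma contains_c0_of_wuc (X : completeNormedModType R) (y : nat -> X) (e : R) :
  0 < e -> wuc y -> (forall n, e <= `|y n|) -> contains_copy X (c0 R).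
Proof.
move=> e0 yC ye.
have /choice[g gP] n := norming_functional (y n).
have [K K0 yK] := wuc_bound yC.
have e2 : 0 < e / 2 by rewrite divr_gt0.
have [||s si sP] := @rosenthal_disjointness _ (fun n k => `|g n (y k)|) K _ e2.
- by [].
- move=> n r ur.
  have -> : \sum_(k <- r) `|g n (y k)| = g n (\sum_(k <- r) Num.sg (g n (y k)) *: y k).
    by rewrite linear_sum; apply: eq_bigr => k _; rewrite linearZ [LHS]normrEsg.
  rewrite (le_trans (ler_norm _))// (le_trans ((gP n).1 _))// -[K]mulr1 yK// => k.
  by rewrite normr_sg; case: eqP.
have zC := wuc_comp si yC; have [L L0 zL] := wuc_bound zC.
apply: (@contains_copy_series _ _ _ (fun a : c0 R => a) (y \o s) L _ e2) => //.
- by move=> a; exact: cvg_c0_series.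
- move=> a n; rewrite -(big_mkord xpredT (fun i => a i *: (y \o s) i)).
  by apply: zL => [|k]; [exact: iota_uniq|exact: c0_apply_le].
- move=> a l al.
  (* The error term, half of [e * |a|], is absorbed into the left-hand side after taking the
     supremum over [j]. *)
  suff : `|a| <= (l + e / 2 * `|a|) / e by rewrite ler_pdivlMr//; lra.
  apply: c0_norm_le => j; rewrite ler_pdivlMr// -lerBlDr.
  have [n [jn nl]] := filter_ex (filterI (nbhs_infty_gt j) al).
  apply: le_trans nl; apply: le_trans ((gP (s j)).1 _).
  rewrite linear_sum (bigD1 (Ordinal jn))//=.
  set w := \sum_(i < n | _) _.
  have -> : g (s j) (a j *: y (s j)) = a j * `|y (s j)|.
    by rewrite linearZ /= (gP (s j)).2.
  have : `|w| <= e / 2 * `|a|.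
    rewrite (le_trans (ler_norm_sum _ _ _))// mulrC.
    apply: (@le_trans _ _ (`|a| * \sum_(k < n | k != j :> nat) `|g (s j) (y (s k))|)).
      rewrite mulr_sumr; apply: ler_sum => k _.
      by rewrite linearZ normrM ler_wpM2r// c0_apply_le.
    by rewrite ler_wpM2l.
  have : `|a j| * e <= `|a j * `|y (s j)| |.
    by rewrite normrM normr_id ler_wpM2l.
  have := ler_normB (a j * `|y (s j)| + w) w; rewrite addrK; lra.
Qed.

End WeaklyUnconditionallyCauchy.

(** * Reflexive spaces contain neither c0 nor l1 *)

Section ReflexiveNoCopy.
Context {R : realType}.

(** Compactness of the segment gives a cluster point, and an ultrafilter converges to each of its
    cluster points. *)
Lemma bounded_ultra_cvg (T : Type) (U : set_system T) (f : T -> R) (B : R) :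
  UltraFilter U -> (forall t, `|f t| <= B) -> cvg (f t @[t --> U]).
Proof.
move=> UU fB; have UP := @ultra_proper _ _ UU.
have [|r [_ rU]] := @segment_compact R (- B) B (f t @[t --> U]) _.
  apply: (@filterS _ U UP setT) => [t _|]; last exact: filterT.
  by rewrite /= in_itv /= -ler_norml.
apply/cvg_ex; exists r => A rA.
have [//|UA] := in_ultra_setVsetC (f @^-1` A) UU.
by have [x [/=]] := rU (~` A) A UA rA.
Qed.

(* The limits along an ultrafilter, tested against functionals, are represented
   by a point of [X]; closed subspaces being weakly closed, it is in [range T]. *)
Lemma reflexive_ultralimit (X Y : normedModType R) (T : {linear Y -> X})
    (v : nat -> Y) (B C : R) :
  reflexive_space X -> closed (range T) -> (forall a, `|T a| <= C * `|a|) ->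
  (forall n, `|v n| <= B) ->
  exists (U : set_system nat) (a : Y), [/\ ProperFilter U, \oo `<=` U &
    forall g : dual X, g (T (v n)) @[n --> U] --> g (T a)].
Proof.
move=> rX cT TC vB.
have [U [UU oU]] := @ultraFilterLemma _ \oo _.
have UP := @ultra_proper _ _ UU.
have gb (g : dual X) n : `|g (T (v n))| <= (`|C| * B) * `|g|.
  rewrite (le_trans (dual_apply_le _ _))// mulrC ler_wpM2r// (le_trans (TC _))//.
  rewrite (@le_trans _ _ (`|C| * `|v n|))// ?ler_wpM2r// ?ler_wpM2l//.
  exact: ler_norm.
have gU (g : dual X) : cvg (g (T (v n)) @[n --> U]).
  exact: bounded_ultra_cvg (gb g).
pose p (g : dual X) : R := lim (g (T (v n)) @[n --> U]).
have pl : linear (p : dual X -> R^o).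
  move=> k g h; apply: cvg_lim => //.
  by apply: cvgD; [apply: cvgZl_tmp; exact: gU|exact: gU].
have [|phi phiE] := @dual_of_bounded _ _ p (`|C| * B) pl.
  move=> g; apply: (@cvg_le_bound _ _ U _ (fun n => `|g (T (v n))|)).
    by apply: cvg_norm; exact: gU.
  by apply: nearW => n; exact: gb.
have [y _ yphi] : range (@bidual_embedding R X) phi by rewrite rX.
have gy (g : dual X) : g (T (v n)) @[n --> U] --> g y.
  suff -> : g y = p g by exact: gU.
  by rewrite -phiE -yphi.
have [[a _ ay]|yT] := pselect (range T y); last first.
  have [g gT /eqP[]] := separation_closed_range cT yT.
  have E : (fun n => g (T (v n))) = cst 0 by apply/funext => n; rewrite gT.
  have := gy g; rewrite [X in X @ _]E => /(cvg_lim (@Rhausdorff R)) <-.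
  by rewrite lim_cst.
by exists U, a; split => // g; rewrite ay.
Qed.

(** Continuity of the inverse at 0 gives a radius [d] on which it is bounded by 1. Rescaling [a] so
    that [|T a|] becomes [d / 2] yields the constant [2 / d]. *)
Lemma copy_bounds (X Y : normedModType R) : contains_copy X Y ->
  exists (T : {linear Y -> X}) (C c : R), [/\ closed (range T), 0 <= c,
    (forall a, `|T a| <= C * `|a|) & (forall a, `|a| <= c * `|T a|)].
Proof.
move=> [T [S [cT Tc TK /subspace_continuousP Sc]]].
have /linear_bounded_continuous/linear_boundedP/pinfty_ex_gt0[C C0 TC] := Tc.
have := Sc (T 0) (ex_intro2 _ _ 0 I erefl).
move=> /cvgrPdist_lt/(_ 1 ltr01)/nbhs_ballP[d /= d0 dS].
exists T, C, (2 / d); split => //; first by rewrite divr_ge0// ltW.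
move=> a; have [->|a0] := eqVneq a 0; first by rewrite normr0 mulr_ge0// divr_ge0// ltW.
pose t := d / 2 / `|T a|.
have Ta0 : T a != 0 by apply: contra_neq a0 => Ta0; rewrite -(TK a) Ta0 -(linear0 T) TK.
have Tap : 0 < `|T a| by rewrite normr_gt0.
have t0 : 0 < t by rewrite !divr_gt0.
have bT : ball (T 0) d (T (t *: a)).
  rewrite -ball_normE /= linear0 sub0r normrN linearZ normrZ.
  by rewrite gtr0_norm// divfK ?gt_eqF//; lra.
have := dS _ bT (ex_intro2 _ _ (t *: a) I erefl).
rewrite /from_subspace !TK sub0r normrN normrZ gtr0_norm//.
rewrite -ltr_pdivlMl// => /ltW /le_trans; apply.
by rewrite /t mulr1 !invf_div [leLHS]mulrC mulrC.
Qed.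

(** Each coordinate functional, extended to [X] through [T], is eventually 1 on the vectors
    [e_0 + ... + e_(n-1)] of the unit ball. Their limit would be the constant sequence 1, which is
    not null. *)
Lemma reflexive_no_c0 (X : normedModType R) : reflexive_space X -> ~ contains_copy X (c0 R).
Proof.
move=> rX /copy_bounds[T [C [c [cT cge0 TC Tc]]]].
have sP n : ((fun k => (k < n)%:R) : nat -> R^o) \in @c0_pred R.
  apply/asboolP; apply: cvg_near_cst; exists n => //= k /=.
  by rewrite ltnNge => ->.
have s1 n : `|C0 (sP n)| <= 1.
  by apply: c0_norm_le => k /=; case: ltnP; rewrite ?normr1 ?normr0.
have [U [a [UP oU aU]]] := reflexive_ultralimit rX cT TC s1.
have a1 k : a k = 1.
  have hl : linear (fun u : c0 R => u k : R^o) by [].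
  pose h := HB.pack_for {linear c0 R -> R^o} (fun u : c0 R => u k : R^o)
    (GRing.isLinear.Build _ _ _ _ _ hl).
  have [|u|g gT] := @hahn_banach_extension _ _ _ T c h; first by [].
    by rewrite (le_trans (ler_norm _))// (le_trans _ (Tc u))// c0_apply_le.
  have := aU g; rewrite gT => h1.
  have h2 : g (T (C0 (sP n))) @[n --> U] --> (1 : R).
    apply: cvg_near_cst; apply: oU; exists k.+1 => // n /= kn.
    by rewrite gT /= kn.
  exact: (cvg_unique (@Rhausdorff R) h1 h2).
have /asboolP/cvgrPdist_lt/(_ 1 ltr01)/filter_ex[n] := c0P a.
by rewrite a1 sub0r normrN normr1 ltxx.
Qed.

(** Each coordinate of [e_n] is eventually 0, so the limit point is 0. The sum of all coordinates, a
    bounded functional on l1, is however 1 at every [e_n]. *)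
Lemma reflexive_no_l1 (X : normedModType R) : reflexive_space X -> ~ contains_copy X (l1 R).
Proof.
move=> rX /copy_bounds[T [C [c [cT cge0 TC Tc]]]].
have psum n m : \sum_(k < m) `|(k == n :> nat)%:R : R| <= 1.
  have -> : \sum_(k < m) `|(k == n :> nat)%:R : R| = \sum_(k < m | k == n :> nat) 1.
    by rewrite [RHS]big_mkcond; apply: eq_bigr => k _; case: eqP; rewrite ?normr1 ?normr0.
  have [nm|mn] := ltnP n m.
    by rewrite (big_pred1 (Ordinal nm)).
  rewrite big_pred0 ?ler01// => k; apply/negbTE; rewrite neq_ltn.
  by rewrite (leq_trans (ltn_ord k)).
have eP n : ((fun k => (k == n)%:R) : nat -> R^o) \in @l1_pred R.
  exact: (@l1_mem _ _ 1).
have e1 n : `|L1 (eP n)| <= 1 by apply: l1_norm_leP => m; exact: psum.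
have [U [a [UP oU aU]]] := reflexive_ultralimit rX cT TC e1.
have a0 k : a k = 0.
  have hl : linear (fun u : l1 R => u k : R^o) by [].
  pose h := HB.pack_for {linear l1 R -> R^o} (fun u : l1 R => u k : R^o)
    (GRing.isLinear.Build _ _ _ _ _ hl).
  have [|u|g gT] := @hahn_banach_extension _ _ _ T c h; first by [].
    by rewrite (le_trans (ler_norm _))// (le_trans _ (Tc u))// l1_apply_le.
  have := aU g; rewrite gT => h1.
  have h2 : g (T (L1 (eP n))) @[n --> U] --> (0 : R).
    apply: cvg_near_cst; apply: oU; exists k.+1 => // n /= kn.
    by rewrite gT /= ltn_eqF.
  exact: (cvg_unique (@Rhausdorff R) h1 h2).
have cu (u : l1 R) : cvgn (series (u : nat -> R)) by apply: normed_cvg; exact: l1_cvg.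
pose hs (u : l1 R) : R := limn (series (u : nat -> R)).
have hl : linear (hs : l1 R -> R^o).
  move=> k u w; apply: cvg_lim => //.
  have -> : series ((k *: u + w : l1 R) : nat -> R) =
      (fun n => k *: (series (u : nat -> R) n : R^o) + series (w : nat -> R) n).
    by apply/funext => n; rewrite /series /= scaler_sumr -big_split.
  by apply: cvgD; [apply: cvgZl_tmp; exact: cu|exact: cu].
pose h := HB.pack_for {linear l1 R -> R^o} (hs : l1 R -> R^o)
  (GRing.isLinear.Build _ _ _ _ _ hl).
have [|u|g gT] := @hahn_banach_extension _ _ _ T c h; first by [].
  rewrite (le_trans (ler_norm _))// (le_trans _ (Tc u))//.
  apply: (@cvg_le_bound _ _ \oo _ (fun n => `|series (u : nat -> R) n|)).
    by apply: cvg_norm; exact: cu.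
  apply: nearW => n; rewrite (le_trans _ (l1_partial_le u n))//.
  by rewrite /series /= big_mkord ler_norm_sum.
have ga : g (T a) = 0.
  rewrite gT /= /hs; have -> : series (a : nat -> R) = cst 0.
    by apply/funext => n; rewrite /series /= big1.
  exact: lim_cst.
have g1 n : g (T (L1 (eP n))) = 1.
  rewrite gT /= /hs; apply: cvg_lim => //; apply: cvg_near_cst.
  exists n.+1 => // m /= nm; rewrite /series /= big_mkord.
  rewrite (bigD1 (Ordinal nm))//= eqxx big1 ?addr0// => k /negbTE kn.
  by move: kn; rewrite -val_eqE /= => ->.
have := aU g; rewrite ga (_ : (fun n => _) = cst 1); last exact/funext.
by move=> /(cvg_lim (@Rhausdorff R)); rewrite lim_cst// => /eqP; rewrite oner_eq0.
Qed.

End ReflexiveNoCopy.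

(** * Real integrals: differences of sets, disjoint sums, exhaustions *)

Section RealIntegral.
Context {R : realType} d {M : measurableType d}.
Variable mu : {measure set M -> \bar R}.
Implicit Types (A B : set M) (h : M -> R) (E : nat -> set M).

Lemma measurable_fun_open_preimage (h : M -> R) A :
  (forall U, open U -> measurable (h @^-1` U)) -> measurable_fun A h.
Proof.
move=> hU; apply: (@measurable_funS _ _ _ _ setT) => //.
apply: (measurability _ (RGenOInfty.measurableE R)).
by move=> _ [_ [a ->] <-]; rewrite setTI; apply: hU.
Qed.

Lemma Rintegral_setD A B h : measurable A -> measurable B -> A `<=` B ->
  mu.-integrable B (EFin \o h) ->
  \int[mu]_(t in B `\` A) h t = \int[mu]_(t in B) h t - \int[mu]_(t in A) h t.
Proof.
move=> mA mB AB ih; have BE : B = (B `\` A) `|` A by rewrite setDKU.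
rewrite [X in _ = Rintegral _ X _ - _]BE Rintegral_setU ?addrK//.
- exact: measurableD.
- by rewrite -BE.
- by apply/disj_setPS => t [[_ ?]].
Qed.

Lemma le_Rintegral_subset A B h : measurable A -> measurable B -> A `<=` B ->
  mu.-integrable B (EFin \o h) -> (forall t, B t -> 0 <= h t) ->
  \int[mu]_(t in A) h t <= \int[mu]_(t in B) h t.
Proof.
move=> mA mB AB ih h0; rewrite -subr_ge0 -Rintegral_setD//.
by apply: Rintegral_ge0 => t [/h0].
Qed.

Lemma sum_Rintegral_disjoint (F : nat -> set M) h (r : seq nat) :
  (forall k, measurable (F k)) -> trivIset setT F -> uniq r ->
  mu.-integrable (\big[setU/set0]_(k <- r) F k) (EFin \o h) ->
  \sum_(k <- r) \int[mu]_(t in F k) h t =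
    \int[mu]_(t in \big[setU/set0]_(k <- r) F k) h t.
Proof.
move=> mF tF; have mU (s : seq nat) : measurable (\big[setU/set0]_(k <- s) F k).
  by apply: bigsetU_measurable => k _; exact: mF.
elim: r => [_|k r IH /= /andP[kr ur]].
  by rewrite !big_nil Rintegral_set0.
rewrite !big_cons => ih; rewrite IH//; last first.
  by apply: integrableS ih => //; exact: measurableU.
rewrite Rintegral_setU//; apply/disj_setPS => t [Fk].
rewrite -bigcup_seq => -[j /= jr Fj].
have jk : j = k by apply: (tF j k) => //; exists t.
by move: kr; rewrite -jk jr.
Qed.

Lemma integrable_normr A h : measurable A -> mu.-integrable A (EFin \o h) ->
  mu.-integrable A (EFin \o (fun t => `|h t|)).
Proof. by move=> mA /integrable_norm. Qed.

Lemma integrable_cst A (k : R) : measurable A -> (mu A < +oo)%E ->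
  mu.-integrable A (EFin \o (fun=> k)).
Proof.
move=> mA Afin; apply: measurable_bounded_integrable => //.
by exists `|k|; rewrite num_real; split=> // r /ltW kr t _.
Qed.

Lemma integrable_mulr A h (k : R) : measurable A -> mu.-integrable A (EFin \o h) ->
  mu.-integrable A (EFin \o (fun t => h t * k)).
Proof. by move=> mA ih; exact: (integrableZr mA k ih). Qed.

Lemma integrable_mull A h (k : R) : measurable A -> mu.-integrable A (EFin \o h) ->
  mu.-integrable A (EFin \o (fun t => k * h t)).
Proof. by move=> mA ih; exact: (integrableZl mA k ih). Qed.

(** Splitting [A] by the sign of [h], each of the two parts contributes at most [K]. Bounds on set
    integrals thereby become bounds on L1 norms. *)
Lemma Rintegral_normr_le A h K : measurable A -> mu.-integrable A (EFin \o h) ->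
  (forall B, measurable B -> B `<=` A -> `|\int[mu]_(t in B) h t| <= K) ->
  \int[mu]_(t in A) `|h t| <= 2 * K.
Proof.
move=> mA ih hK.
have mh : measurable_fun A h by apply/measurable_EFinP; exact: measurable_int ih.
pose P := A `&` h @^-1` `[0, +oo[.
have mP : measurable P by apply: mh => //; exact: measurable_itv.
have PA : P `<=` A by move=> t [].
have mD : measurable (A `\` P) by exact: measurableD.
have AE : A = P `|` (A `\` P) by rewrite setUC setDKU.
rewrite AE Rintegral_setU//; last 2 first.
- by rewrite -AE; exact: integrable_normr.
- by apply/disj_setPS => t [? []].
rewrite mulr_natl mulr2n lerD//.
  rewrite (_ : Rintegral _ _ _ = \int[mu]_(t in P) h t).
    by rewrite (le_trans (ler_norm _))// hK.
  apply: eq_Rintegral => t; rewrite inE => -[_ /=].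
  by rewrite in_itv/= andbT => /ger0_norm.
rewrite (_ : Rintegral _ _ _ = - \int[mu]_(t in A `\` P) h t).
  by rewrite (le_trans (ler_norm _))// normrN hK// => t [].
rewrite -mulN1r -RintegralZl//; last by apply: integrableS ih => // t [].
apply: eq_Rintegral => t; rewrite inE => -[At nP]; rewrite mulN1r ltr0_norm//.
rewrite ltNge; apply/negP => h0; apply: nP; split => //=.
by rewrite in_itv/= h0.
Qed.

Lemma Rintegral_exhaust_le E A h K : measurable A -> (forall n, measurable (E n)) ->
  nondecreasing_seq E -> \bigcup_n E n = setT ->
  mu.-integrable A (EFin \o h) -> (forall t, A t -> 0 <= h t) ->
  (forall n, \int[mu]_(t in A `&` E n) h t <= K) ->
  \int[mu]_(t in A) h t <= K.
Proof.
move=> mA mE ndE ET ih h0 hK.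
have mAE n : measurable (A `&` E n) by exact: measurableI.
have iAE n : mu.-integrable (A `&` E n) (EFin \o h).
  by apply: integrableS ih => // t [].
have := @ge0_nondecreasing_set_cvg_integral _ _ _ (fun n => A `&` E n) (EFin \o h) mu.
move=> /(_ _ mAE _ _)/wrap[].
- by move=> m n mn; rewrite subsetEset; apply: setIS; rewrite -subsetEset; exact: ndE.
- by move=> n; exact: measurable_int (iAE n).
- by move=> n t [/h0].
rewrite -setI_bigcupr ET setIT => cv.
rewrite -lee_fin /Rintegral fineK; last exact: integrable_fin_num.
rewrite -(cvg_lim _ cv)//; apply: lime_le; first by apply/cvg_ex; eexists; exact: cv.
apply: nearW => n; have := hK n; rewrite -lee_fin /Rintegral fineK//.
exact: integrable_fin_num.
Qed.

Lemma mu_exhaust E A (e : R) : measurable A -> (mu A < +oo)%E ->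
  (forall n, measurable (E n)) -> nondecreasing_seq E -> \bigcup_n E n = setT ->
  0 < e -> \forall n \near \oo, fine (mu (A `\` E n)) <= e.
Proof.
move=> mA Afin mE ndE ET e0.
have mD n : measurable (A `\` E n) by exact: measurableD.
have := @nonincreasing_cvg_mu _ _ _ mu (fun n => A `\` E n).
rewrite bigcupDr ?ET ?setDT ?measure0; last by exists 0%N.
move=> // /(_ _ mD measurable0 _)/wrap[].
- by rewrite (le_lt_trans _ Afin)// le_measure// ?inE//.
- by move=> m n mn; rewrite subsetEset; apply: setDS; rewrite -subsetEset; exact: ndE.
move=> /fine_cvgP[_] /cvgrPdist_le/(_ _ e0); apply: filterS => n.
by rewrite sub0r normrN => /(le_trans (ler_norm _)).
Qed.

End RealIntegral.

(** * Measurability and integrability of the frame coefficients *)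

Section FrameBasics.
Context {R : realType} {X : completeNormedModType R} d {M : measurableType d}.
Context (mu : {sigma_finite_measure set M -> \bar R}).
Context (x : M -> X) (f : M -> dual X).
Hypothesis frame : continuous_schauder_frame mu x f.
Implicit Types (A B E : set M) (phi : dual (dual X)) (g h : dual X) (y z : X).

Local Notation J := (@bidual_embedding R X).

Lemma frame_measurable_preimage (Z : topologicalType) (Psi : X * dual X -> Z)
    (U : set Z) : continuous Psi -> open U ->
  measurable [set t | U (Psi (x t, f t))].
Proof.
move=> cPsi oU; have [mf _] := frame.
have := mf measurableT (Psi @^-1` U); rewrite setTI; apply.
by apply: sub_sigma_algebra; move/continuousP: cPsi; exact.
Qed.

Lemma frame_measurable_real (Psi : X * dual X -> R) : continuous Psi ->
  measurable_fun setT (fun t => Psi (x t, f t)).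
Proof.
move=> cPsi; apply: measurable_fun_open_preimage => U.
exact: frame_measurable_preimage.
Qed.

(* [frame_coef (bidual_embedding y) g] is the coefficient function
   [t |-> f_t(y) g(x_t)]. *)
Definition frame_coef phi g (t : M) : R := phi (f t) * g (x t).

Lemma measurable_frame_coef phi g A : measurable_fun A (frame_coef phi g).
Proof.
apply: (@measurable_funS _ _ _ _ setT) => //.
apply: (frame_measurable_real (Psi := fun p => phi p.2 * g p.1)) => p.
apply: cvgM.
  by apply: (@continuous_comp _ _ _ snd phi); [exact: cvg_snd|exact: dual_continuous].
by apply: (@continuous_comp _ _ _ fst g); [exact: cvg_fst|exact: dual_continuous].
Qed.

Lemma frame_measurable_le (Psi : X * dual X -> R) (a : R) : continuous Psi ->
  measurable [set t | Psi (x t, f t) <= a].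
Proof.
move=> cPsi; rewrite (_ : [set t | _] = ~` [set t | a < Psi (x t, f t)]).
  by apply/measurableC/(@frame_measurable_preimage _ Psi [set r | a < r])/open_gt.
by apply/seteqP; split=> t /=; rewrite leNgt => /negP.
Qed.

Lemma measurable_norm_le (a : R) :
  measurable [set t | `|x t| <= a /\ `|f t| <= a].
Proof.
apply: measurableI.
  by apply: (@frame_measurable_le (fun p => `|p.1|)) => p; apply: cvg_norm; exact: cvg_fst.
by apply: (@frame_measurable_le (fun p => `|p.2|)) => p; apply: cvg_norm; exact: cvg_snd.
Qed.

Lemma frame_coef_le phi g t : `|frame_coef phi g t| <= `|phi| * `|g| * (`|f t| * `|x t|).
Proof.
rewrite /frame_coef normrM mulrACA.
by rewrite ler_pM// dual_apply_le.
Qed.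

Lemma frame_dir_bound A : frame_dir mu x f A ->
  exists2 C, 0 <= C & forall t, A t -> `|f t| * `|x t| <= C.
Proof.
move=> [_ _ [C AC]]; exists (Num.max C 0); first by rewrite le_max lexx orbT.
by move=> t At; rewrite le_max AC//; exists t.
Qed.

Lemma frame_dirS A B : measurable A -> A `<=` B -> frame_dir mu x f B ->
  frame_dir mu x f A.
Proof.
move=> mA AB [mB Bfin [C BC]]; split => //.
  by rewrite (le_lt_trans _ Bfin)// le_measure ?inE.
by exists C => _ [t At <-]; apply: BC; exists t => //; exact: AB.
Qed.

Lemma frame_dir_measurable A : frame_dir mu x f A -> measurable A.
Proof. by case. Qed.

Lemma integrable_coef_dir phi g A : frame_dir mu x f A ->
  mu.-integrable A (EFin \o frame_coef phi g).
Proof.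
move=> dA; have [C C0 AC] := frame_dir_bound dA; have [mA Afin _] := dA.
apply: measurable_bounded_integrable => //; first exact: measurable_frame_coef.
exists (`|phi| * `|g| * C); rewrite num_real; split=> // r /ltW Cr t At /=.
rewrite (le_trans (frame_coef_le _ _ _))// (le_trans _ Cr)//.
by rewrite ler_wpM2l ?AC// mulr_ge0.
Qed.

Lemma Rintegral_coef_dir_le phi g A C : frame_dir mu x f A ->
  (forall t, A t -> `|f t| * `|x t| <= C) ->
  `|\int[mu]_(t in A) frame_coef phi g t| <= `|phi| * `|g| * C * fine (mu A).
Proof.
move=> dA AC; have [mA Afin _] := dA.
have ic := integrable_coef_dir phi g dA.
rewrite (le_trans (le_normr_Rintegral _ ic))//.
rewrite -Rintegral_cst//; apply: le_Rintegral => //.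
- exact: integrable_normr.
- exact: integrable_cst.
- move=> t At; rewrite (le_trans (frame_coef_le _ _ _))//.
  by rewrite ler_wpM2l ?AC// mulr_ge0.
Qed.

Lemma pettis_integralP A (F : M -> X) : (exists y, is_pettis_integral mu A F y) ->
  is_pettis_integral mu A F (pettis_integral mu A F).
Proof. by move=> [y Fy]; apply: (@xgetPex _ 0 (is_pettis_integral mu A F)); exists y. Qed.

Lemma pettis_coef A (phi : M -> R) g y :
  is_pettis_integral mu A (fun t => phi t *: x t) y ->
  mu.-integrable A (EFin \o (fun t => phi t * g (x t))) /\
  g y = \int[mu]_(t in A) (phi t * g (x t)).
Proof.
move=> /(_ g)[ig gy].
have E : (fun t => (g (phi t *: x t))%:E) = EFin \o (fun t => phi t * g (x t)).
  by apply/funext => t /=; rewrite linearZ.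
by move: ig gy; rewrite E /Rintegral => ig <-.
Qed.

Lemma integrable_coef y g A : measurable A ->
  mu.-integrable A (EFin \o frame_coef (J y) g).
Proof.
move=> mA; have [_ /(_ y)[+ _]] := frame.
by move=> /(_ A mA)[z /(pettis_coef g)[]].
Qed.

Lemma coef_tail_operator y g A : measurable A ->
  g (tail_operator mu x f A y) = \int[mu]_(t in ~` A) frame_coef (J y) g t.
Proof.
move=> mA; have [_ /(_ y)[+ _]] := frame.
by move=> /(_ (~` A) (measurableC mA))/pettis_integralP/(pettis_coef g)[_].
Qed.

Lemma coef_reconstruction y g : g y = \int[mu]_t frame_coef (J y) g t.
Proof.
have [_ /(_ y)[+ yE]] := frame; rewrite [in LHS]yE.
by move=> /(_ setT measurableT)/pettis_integralP/(pettis_coef g)[_].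
Qed.

Lemma frame_coefZ a y g t : frame_coef (J (a *: y)) g t = a * frame_coef (J y) g t.
Proof. by rewrite /frame_coef /= linearZ mulrA. Qed.

Lemma frame_coefD y z g t :
  frame_coef (J (y + z)) g t = frame_coef (J y) g t + frame_coef (J z) g t.
Proof. by rewrite /frame_coef /= linearD mulrDl. Qed.

(** A sigma-finite exhaustion is cut by the sets where both norms are at most [n]. The last clause
    bounds [x t] and [f t] separately, whereas membership in [frame_dir] bounds only the product of
    their norms. *)
Lemma frame_exhaustion : exists E : nat -> set M,
  [/\ forall n, frame_dir mu x f (E n), nondecreasing_seq E,
    \bigcup_n E n = setT &
    forall n, exists C, forall t, E n t -> `|x t| <= C /\ `|f t| <= C].
Proof.
have [F [FT ndF mF]] := (sigma_finiteP setT mu).1 (sigma_finiteT mu).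
pose E n := F n `&` [set t | `|x t| <= n%:R /\ `|f t| <= n%:R].
have mE n : measurable (E n).
  by apply: measurableI; [exact: (mF n).1|exact: measurable_norm_le].
exists E; split.
- move=> n; split => //.
    by rewrite (le_lt_trans _ (mF n).2)// le_measure ?inE//; [exact: (mF n).1|move=> t []].
  by exists (n%:R * n%:R) => _ [t [_ [xn fn]] <-]; rewrite ler_pM.
- move=> m n mn; rewrite subsetEset => t [Ft [xm fm]].
  have mn' : m%:R <= n%:R :> R by rewrite ler_nat.
  split; last by split; [exact: le_trans mn'|exact: le_trans mn'].
  by move: t Ft {xm fm}; apply/subsetPset; exact: ndF.
- apply/seteqP; split => // t _.
  have : setT t by []. rewrite FT => -[n _ Fn].
  pose m := maxn n (maxn (Num.truncn `|x t|).+1 (Num.truncn `|f t|).+1).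
  exists m => //; split; last split.
  + by have /subsetPset := ndF _ _ (leq_maxl n _ : (n <= m)%N); exact.
  + rewrite (le_trans (ltW (truncnS_gt _)))// ler_nat.
    by rewrite /m !leq_max leqnn orbT.
  + rewrite (le_trans (ltW (truncnS_gt _)))// ler_nat.
    by rewrite /m !leq_max leqnn !orbT.
- by move=> n; exists n%:R => t [_].
Qed.

End FrameBasics.

(** * Approximation of bounded vector functions by step functions *)

Section StepApproximation.
Context {R : realType} {X : completeNormedModType R} d {M : measurableType d}.
Context (mu : {measure set M -> \bar R}).
Implicit Types (A B E : set M) (g : dual X).

Lemma separable_dense_seq : separable_space X ->
  exists a : nat -> X, forall z e, 0 < e -> exists k, `|z - a k| < e.
Proof.
move=> [S [/countable_injP[i iS] dS]].
exists (fun k => xget 0 [set s | S s /\ i s = k]) => z e e0.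
have [||s [zs Ss]] := dS (ball z e); [by exists z; exact: ballxx|exact: ball_open|].
exists (i s); case: xgetP => [s' _ [Ss' is']|/(_ s)]; last by move=> h; exfalso; apply: h.
have -> : s' = s by apply: iS => //; exact: mem_set.
by move: zs; rewrite -ball_normE.
Qed.

(** Balls of radius [e] around a dense sequence cover [X]; their preimages are made disjoint. The
    part [B] of [E] missed by the first [N] has small measure, and there the step function is 0
    while [F] is at most [C]. *)
Lemma step_approximation E (F : M -> X) (C e : R) : separable_space X ->
  measurable E -> (mu E < +oo)%E ->
  (forall U, open U -> measurable (F @^-1` U)) ->
  (forall t, E t -> `|F t| <= C) -> 0 < e ->
  exists N (A : nat -> set M) (a : nat -> X) B,
    [/\ forall k, measurable (A k), measurable B, B `<=` E, fine (mu B) <= e &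
      forall t, E t ->
        `|F t - \sum_(k < N) \1_(A k) t *: a k| <= e + C * \1_B t].
Proof.
move=> /separable_dense_seq[a adense] mE Efin Fopen FC e0.
pose Q k := F @^-1` ball (a k) e.
have mQ k : measurable (Q k) by apply: Fopen; exact: ball_open.
have mA k : measurable (seqDU Q k) by exact: seqDU_measurable.
pose EU n := \big[setU/set0]_(k < n) Q k.
have mEU n : measurable (EU n) by apply: bigsetU_measurable => k _; exact: mQ.
have ndEU : nondecreasing_seq EU.
  move=> m n mn; rewrite subsetEset; exact: subset_bigsetU.
have EUT : \bigcup_n EU n = setT.
  apply/seteqP; split => // t _; have [k tk] := adense (F t) e e0.
  exists k.+1 => //; rewrite /EU big_ord_recr /=; right.
  by rewrite /Q /= -ball_normE /= distrC.
have [N muN] := filter_ex (mu_exhaust mE Efin mEU ndEU EUT e0).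
exists N, (seqDU Q), a, (E `\` EU N); split => //.
- exact: measurableD.
- move=> t Et; have [EUt|nEUt] := pselect (EU N t).
  + have nBt : ~ (E `\` EU N) t by move=> [_ /(_ EUt)].
    move: (EUt); rewrite {1}/EU bigsetU_seqDU -bigcup_mkord => -[k /= kN Akt].
    rewrite (bigD1 (Ordinal kN))//= indicE mem_set// scale1r big1 ?addr0.
      have : Q k t by exact: subset_seqDU Akt.
      rewrite {1}/Q /= -ball_normE /= distrC => /ltW /le_trans; apply.
      by rewrite indicE memNset ?mulr0 ?addr0.
    move=> j jk; rewrite indicE memNset ?scale0r// => Ajt.
    move: jk; rewrite -val_eqE /= => /eqP; apply.
    by apply: (@trivIset_seqDU _ Q j k) => //; exists t.
  + rewrite big1 ?subr0 => [|k _].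
      by rewrite indicE mem_set// mulr1 (le_trans (FC t Et))// lerDr ltW.
    rewrite indicE memNset ?scale0r// => Akt; apply: nEUt.
    rewrite /EU bigsetU_seqDU -bigcup_mkord; exists k => //=; exact: ltn_ord.
Qed.

Lemma Rintegral_sum N (h : nat -> M -> R) A : measurable A ->
  (forall k, mu.-integrable A (EFin \o h k)) ->
  mu.-integrable A (EFin \o (fun t => \sum_(k < N) h k t)) /\
  \int[mu]_(t in A) (\sum_(k < N) h k t) = \sum_(k < N) \int[mu]_(t in A) h k t.
Proof.
move=> mA ih; elim: N => [|N [IH1 IH2]].
  have E0 : (fun t : M => \sum_(k < 0) h k t) = cst 0.
    by apply/funext => t; rewrite big_ord0.
  rewrite E0 big_ord0 Rintegral_cst// mul0r; split => //.
  exact: integrable0.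
have E1 : (fun t : M => \sum_(k < N.+1) h k t) =
    (fun t => \sum_(k < N) h k t + h N t).
  by apply/funext => t; rewrite big_ord_recr.
rewrite E1 big_ord_recr /= -IH2 RintegralD//; split => //.
exact: (integrableD mA IH1 (ih N)).
Qed.

(** The step function depends neither on the weight [w] nor on [g]. This uniformity turns it into an
    approximation of operators by finite-rank ones. *)
Lemma weighted_step_approximation E (F : M -> X) (C e : R) : separable_space X ->
  measurable E -> (mu E < +oo)%E ->
  (forall U, open U -> measurable (F @^-1` U)) ->
  0 <= C -> (forall t, E t -> `|F t| <= C) -> 0 < e ->
  exists N (A : nat -> set M) (a : nat -> X), (forall k, measurable (A k)) /\
    forall (w : M -> R) (W : R) g, 0 <= W -> measurable_fun E w ->
      (forall t, E t -> `|w t| <= W) ->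
      `|\int[mu]_(t in E) (w t * g (F t))
        - \sum_(k < N) (\int[mu]_(t in E) (w t * \1_(A k) t)) * g (a k)|
      <= W * `|g| * e.
Proof.
move=> sX mE Efin Fopen C0 FC e0.
(* With accuracy [e / K], the pointwise error integrates to at most [(mu E + C) * (e / K) <= e]; the
   summand 1 keeps [K] positive. *)
pose K := fine (mu E) + C + 1.
have K0 : 0 < K by rewrite /K ltr_wpDl// addr_ge0// fine_ge0.
have [N [A [a [B [mA mB BE muB FA]]]]] :=
  step_approximation sX mE Efin Fopen FC (divr_gt0 e0 K0).
exists N, A, a; split=> // w W g W0 mw wW.
have bint (h : M -> R) K' : measurable_fun E h -> (forall t, E t -> `|h t| <= K') ->
    mu.-integrable E (EFin \o h).
  move=> mh hK; apply: measurable_bounded_integrable => //.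
  by exists K'; rewrite num_real; split=> // r /ltW Kr t Et; exact: le_trans (hK t Et) Kr.
have iF : mu.-integrable E (EFin \o (fun t => w t * g (F t))).
  apply: (bint _ (W * (`|g| * C))).
    apply: measurable_funM => //; apply: measurable_fun_open_preimage => U oU.
    have := Fopen (g @^-1` U); apply.
    by have /continuousP := @dual_continuous _ _ g; apply.
  move=> t Et; rewrite normrM ler_pM// ?wW//.
  by rewrite (le_trans (dual_apply_le _ _))// ler_wpM2l// FC.
have iA k : mu.-integrable E (EFin \o (fun t => w t * \1_(A k) t)).
  apply: (bint _ W).
    by apply: measurable_funM => //; exact: measurable_indic.
  move=> t Et; rewrite normrM -[leRHS]mulr1 ler_pM// ?wW//.
  by rewrite indicE ger0_norm//; case: (_ \in _).
have iAg k : mu.-integrable E (EFin \o (fun t => w t * \1_(A k) t * g (a k))).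
  exact: integrable_mulr.
have [iS SE] := Rintegral_sum N mE iAg.
under eq_bigr do rewrite -RintegralZr//.
rewrite -SE -RintegralB//.
have iB : mu.-integrable E (EFin \o (fun t => W * `|g| * (e / K + C * \1_B t))).
  apply: (bint _ (W * `|g| * (e / K + C))).
    by do 2![apply: measurable_funM => //; try apply: measurable_funD => //]; exact: measurable_indic.
  move=> t Et; rewrite ger0_norm.
    by rewrite ler_wpM2l ?mulr_ge0// lerD2l ler_piMr// indicE; case: (_ \in _).
  apply: mulr_ge0; first exact: mulr_ge0.
  by apply: addr_ge0; [rewrite ltW// divr_gt0|exact: mulr_ge0].
have iD := integrableB mE iF iS.
rewrite (le_trans (le_normr_Rintegral _ iD))//.
apply: (@le_trans _ _ (\int[mu]_(t in E) (W * `|g| * (e / K + C * \1_B t)))).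
  apply: le_Rintegral => //; first exact: integrable_normr.
  move=> t Et.
  have -> : w t * g (F t) - \sum_(k < N) w t * \1_(A k) t * g (a k) =
      w t * g (F t - \sum_(k < N) \1_(A k) t *: a k).
    have -> : g (F t - \sum_(k < N) \1_(A k) t *: a k) =
        g (F t) - \sum_(k < N) \1_(A k) t * g (a k).
      rewrite linearB linear_sum; congr (_ + - _).
      by apply: eq_bigr => k _; rewrite linearZ.
    by rewrite mulrBr mulr_sumr; under [in RHS]eq_bigr do rewrite mulrA.
  rewrite normrM -mulrA ler_pM// ?wW//.
  by rewrite (le_trans (dual_apply_le _ _))// ler_wpM2l// FA.
have iI : mu.-integrable E (EFin \o \1_B).
  apply: (bint _ 1); first exact: measurable_indic.
  by move=> t _; rewrite indicE; case: (_ \in _); rewrite ?normr1 ?normr0.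
have iCI : mu.-integrable E (EFin \o (fun t => C * \1_B t)).
  exact: integrable_mull.
have icst := integrable_cst (e / K) mE Efin.
rewrite RintegralZl//; last exact: (integrableD mE icst iCI).
rewrite ler_wpM2l ?mulr_ge0// RintegralD// Rintegral_cst// RintegralZl//.
have -> : \int[mu]_(t in E) \1_B t = fine (mu B).
  by rewrite /Rintegral integral_indic// setIidl.
apply: (@le_trans _ _ (e / K * K)); last by rewrite divfK ?gt_eqF.
rewrite {2}/K !mulrDr mulr1 -addrA lerD2l (mulrC (e / K) C).
rewrite (@le_trans _ _ (C * (e / K)))//; first by rewrite ler_wpM2l.
by rewrite lerDl ltW// divr_gt0.
Qed.

End StepApproximation.

(** * Functionals on the dual that come from points of [X] *)

Section Representability.
Context {R : realType} {X : completeNormedModType R}.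

Lemma near_inv_le (K e : R) : 0 < e -> \forall n \near \oo, K / n.+1%:R <= e.
Proof.
move=> e0.
have h : K * n.+1%:R^-1 @[n --> \oo] --> K * 0.
  by apply: cvgMl_tmp; exact: cvg_harmonic.
move: h; rewrite mulr0 => /cvgrPdist_le/(_ _ e0); apply: filterS => n.
by rewrite sub0r normrN => /(le_trans (ler_norm _)).
Qed.

Lemma dual_cvg {T : Type} {F : set_system T} {FF : Filter F} (g : dual X)
    (y : T -> X) z : y @ F --> z -> (g (y t) : R) @[t --> F] --> g z.
Proof.
move=> yz; have : g @ nbhs z --> (g z : R^o) by exact: dual_continuous.
by move=> gz; apply: cvg_trans gz => A /=; exact: (yz (g @^-1` A)).
Qed.

(* [X] is norm closed in its bidual. *)
Lemma approx_representable (psi : dual X -> R) :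
  (forall e, 0 < e -> exists y : X, forall g, `|psi g - g y| <= e * `|g|) ->
  exists z : X, forall g : dual X, g z = psi g.
Proof.
move=> H.
have /choice[y yP] n : exists y : X, forall g, `|psi g - g y| <= n.+1%:R^-1 * `|g|.
  by apply: H; rewrite invr_gt0.
have yy n m : (n <= m)%N -> `|y n - y m| <= 2 / n.+1%:R.
  move=> nm; apply: norm_le_dual => [|g]; first exact: divr_ge0.
  rewrite linearB /= -(subrK (psi g) (g (y n))) -addrA (le_trans (ler_normD _ _))//.
  rewrite mulr_natl mulr2n mulrDl lerD//; first by rewrite distrC.
  by rewrite (le_trans (yP m g))// ler_wpM2r// lef_pV2 ?posrE// ler_nat.
have : cvg (y @ \oo).
  apply: cauchy_cvg; apply/cauchyP => e e0.
  have e2 : 0 < e / 2 by rewrite divr_gt0.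
  have [n nP] := filter_ex (near_inv_le 2 e2).
  exists (y n); apply: (@filterS _ \oo _ [set m | (n <= m)%N]); last exact: nbhs_infty_ge.
  move=> m /= nm; rewrite -ball_normE /= (le_lt_trans (yy _ _ nm))//.
  by rewrite (le_lt_trans nP)//; lra.
move=> /cvg_ex[z yz]; exists z => g.
apply: (@cvg_unique _ (@Rhausdorff R) (g (y n) @[n --> \oo])).
  exact: dual_cvg.
apply/cvgrPdist_le => e e0; apply: filterS (near_inv_le `|g| e0) => n.
by rewrite mulrC; exact: le_trans.
Qed.

Lemma norm_bidual_le (y : X) : `|bidual_embedding y| <= `|y|.
Proof. by apply: dual_norm_leP => // g; rewrite mulrC; exact: (dual_apply_le g y). Qed.

End Representability.

(** * Uniform L1 bounds, the operators [P_A^*], and Pettis integrals over the directed set *)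

Section FrameOperators.
Context {R : realType} {X : completeNormedModType R} d {M : measurableType d}.
Context (mu : {sigma_finite_measure set M -> \bar R}).
Context (x : M -> X) (f : M -> dual X).
Hypothesis sepX : separable_space X.
Hypothesis frame : continuous_schauder_frame mu x f.
Implicit Types (A B E : set M) (phi : dual (dual X)) (g h : dual X) (y z : X).

Local Notation J := (@bidual_embedding R X).
Local Notation coef := (frame_coef x f).

Lemma Rintegral_coef_linear g A : measurable A ->
  linear ((fun y => \int[mu]_(t in A) coef (J y) g t) : X -> R^o).
Proof.
move=> mA a y z.
have ic w := integrable_coef frame w g mA.
rewrite /GRing.scale /= -RintegralZl// -RintegralD//; last exact: integrable_mull.
by apply: eq_Rintegral => t _; rewrite frame_coefD frame_coefZ.
Qed.

(** For [A] in the directed set, [y |-> \int_A f_t(y) g(x_t)] is a bounded functional, and these are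
    pointwise bounded by the L1 norm of the coefficient. Uniform boundedness gives [K]; passing from
    set integrals to absolute values costs a factor 2, and monotone convergence reaches all of
    [M]. *)
Lemma coef_norm_bound g : exists2 C, 0 <= C &
  forall y, \int[mu]_t `|coef (J y) g t| <= C * `|y|.
Proof.
have [E [dE ndE ET _]] := frame_exhaustion frame.
pose I := {A | frame_dir mu x f A}.
have /choice[G GP] (i : I) : exists h : dual X,
    forall y, h y = \int[mu]_(t in sval i) coef (J y) g t.
  have mi := frame_dir_measurable (svalP i).
  have [C C0 AC] := frame_dir_bound (svalP i).
  apply: (dual_of_bounded (C := `|g| * C * fine (mu (sval i))) (Rintegral_coef_linear g mi)).
  move=> y; rewrite (le_trans (Rintegral_coef_dir_le frame _ _ (svalP i) AC))//.
  rewrite -!mulrA [leRHS]mulrCA [leRHS]mulrC -!mulrA [X in _ <= _ * X]mulrC.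
  by rewrite !mulrA ler_wpM2r ?fine_ge0// ler_wpM2r// mulrC ler_wpM2l// norm_bidual_le.
have [|K K0 KP] := @dual_uniform_bounded R X I G.
  move=> y; exists (\int[mu]_t `|coef (J y) g t|) => i; rewrite GP.
  have mi := frame_dir_measurable (svalP i).
  have ic := integrable_coef frame y g mi.
  rewrite (le_trans (le_normr_Rintegral _ ic))// le_Rintegral_subset//.
  by apply: integrable_normr => //; exact: integrable_coef.
exists (2 * K) => [|y]; first by rewrite mulr_ge0.
have mE n := frame_dir_measurable (dE n).
have iT : mu.-integrable setT (EFin \o (fun t => `|coef (J y) g t|)).
  by apply: integrable_normr => //; exact: integrable_coef.
apply: (@Rintegral_exhaust_le _ _ _ mu E) => // n; rewrite setTI -mulrA.
apply: Rintegral_normr_le => //; first exact: integrable_coef.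
move=> B mB BE; have dB := frame_dirS mB BE (dE n).
by rewrite -(GP (exist _ B dB)) (le_trans (dual_apply_le _ _))// ler_wpM2r.
Qed.

Lemma Rintegral_normr_coef_le g C A y : measurable A ->
  (forall y, \int[mu]_t `|coef (J y) g t| <= C * `|y|) ->
  \int[mu]_(t in A) `|coef (J y) g t| <= C * `|y|.
Proof.
move=> mA gC; apply: le_trans (gC y); apply: le_Rintegral_subset => //.
by apply: integrable_normr => //; exact: integrable_coef.
Qed.

(** This is [P_A^* g] for [P_A y = \int_A f_t(y) x_t]. For measurable [A] the default value is not
    taken, by [frame_adjointE]. *)
Definition frame_adjoint A g : dual X :=
  xget 0 [set h : dual X | forall y, h y = \int[mu]_(t in A) coef (J y) g t].

Lemma frame_adjointE A g y : measurable A ->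
  frame_adjoint A g y = \int[mu]_(t in A) coef (J y) g t.
Proof.
move=> mA; have [C C0 gC] := coef_norm_bound g.
suff : exists h : dual X, forall y, h y = \int[mu]_(t in A) coef (J y) g t.
  move=> hP; exact: (@xgetPex _ 0 [set h : dual X | forall y, h y = _] hP y).
apply: (dual_of_bounded (C := C) (Rintegral_coef_linear g mA)) => z.
rewrite (le_trans (le_normr_Rintegral _ (integrable_coef frame z g mA)))//.
exact: Rintegral_normr_coef_le.
Qed.

(** The weak integral is a functional of [g] which step sums, being points of [X], approximate in
    norm; as [X] is closed in its bidual, it is itself a point. *)
Lemma pettis_integral_dir phi A : frame_dir mu x f A ->
  is_pettis_integral mu A (fun t => phi (f t) *: x t)
    (pettis_integral mu A (fun t => phi (f t) *: x t)).
Proof.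
move=> dA; apply: pettis_integralP; have [mA Afin _] := dA.
have [C C0 AC] := frame_dir_bound dA.
pose F t := phi (f t) *: x t.
have Fopen U : open U -> measurable (F @^-1` U).
  move=> oU; apply: (@frame_measurable_preimage _ _ _ _ _ _ _ frame _ (fun p => phi p.2 *: p.1)) => //.
  move=> p; apply: cvgZ; last exact: cvg_fst.
  by apply: (@continuous_comp _ _ _ snd phi); [exact: cvg_snd|exact: dual_continuous].
have FC t : A t -> `|F t| <= `|phi| * C.
  move=> At; rewrite normrZ (le_trans (ler_wpM2r _ (dual_apply_le phi (f t))))//.
  by rewrite -mulrA ler_wpM2l ?AC.
have [z zP] : exists z : X, forall g : dual X, g z = \int[mu]_(t in A) g (F t).
  apply: approx_representable => e e0.
  have [N [S [a [mS SP]]]] := weighted_step_approximation sepX mA Afin Fopen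
    (mulr_ge0 (normr_ge0 phi) C0) FC e0.
  exists (\sum_(k < N) (\int[mu]_(t in A) (1 * \1_(S k) t)) *: a k) => g.
  have := SP (fun=> 1) 1 g ler01 (measurable_cst _).
  have n1 t : A t -> `|(fun=> 1 : R) t| <= 1 by rewrite normr1.
  move=> /(_ n1) SP1.
  rewrite mulrC -[`|g|]mul1r linear_sum; apply: le_trans SP1.
  under [in leLHS]eq_bigr do rewrite linearZ.
  have -> : \int[mu]_(t in A) (1 * g (F t)) = \int[mu]_(t in A) g (F t).
    by apply: eq_Rintegral => t _; rewrite mul1r.
  by [].
exists z => g; have ic := integrable_coef_dir frame phi g dA.
have E : (fun t => (g (phi (f t) *: x t))%:E) = EFin \o coef phi g.
  by apply/funext => t /=; rewrite linearZ.
have -> : g z = \int[mu]_(t in A) coef phi g t.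
  by rewrite zP; apply: eq_Rintegral => t _; rewrite linearZ.
by rewrite E; split => //; rewrite /Rintegral fineK//; exact: integrable_fin_num.
Qed.

End FrameOperators.

(** * Shrinking frames, the bidual, and the gliding humps *)

Section FrameDuality.
Context {R : realType} {X : completeNormedModType R} d {M : measurableType d}.
Context (mu : {sigma_finite_measure set M -> \bar R}).
Context (x : M -> X) (f : M -> dual X).
Hypothesis sepX : separable_space X.
Hypothesis frame : continuous_schauder_frame mu x f.
Implicit Types (A B E : set M) (phi : dual (dual X)) (g h : dual X) (y z : X).

Local Notation J := (@bidual_embedding R X).
Local Notation coef := (frame_coef x f).
Local Notation D := (frame_dir mu x f).
Local Notation adj := (frame_adjoint mu x f).
Local Notation net := (frame_net mu x f).

Lemma dual_sumE (N : nat) (h : 'I_N -> dual X) y : (\sum_(k < N) h k) y = \sum_(k < N) h k y.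
Proof. exact: (linear_sum (J y)). Qed.

Lemma frame_adjoint_norm g : exists2 C, 0 <= C &
  forall A, measurable A -> `|adj A g| <= C.
Proof.
have [C C0 gC] := coef_norm_bound frame g; exists C => // A mA.
apply: dual_norm_leP => // y; rewrite frame_adjointE//.
rewrite (le_trans (le_normr_Rintegral _ (integrable_coef frame y g mA)))//.
exact: Rintegral_normr_coef_le.
Qed.

(** Replacing [x t] by a step function with values [a k] approximates [P_A^*] in norm by
    [g |-> \sum g (a k) *: b k], where [b k] is the weak-star integral of [f] over a piece of [A].
    On such sums [phi] is evaluation at the point [\sum phi (b k) *: a k]. *)
Lemma adjoint_bidual_representable A C phi : D A ->
  (forall t, A t -> `|x t| <= C /\ `|f t| <= C) ->
  exists z : X, forall g : dual X, g z = phi (adj A g).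
Proof.
move=> dA AC; have [mA Afin _] := dA.
have xC t : A t -> `|x t| <= `|C| by move=> /AC[/le_trans + _]; apply; exact: ler_norm.
have fC t y : A t -> `|f t y| <= `|C| * `|y|.
  move=> /AC[_ ftC]; rewrite (le_trans (dual_apply_le _ _))// ler_wpM2r//.
  by rewrite (le_trans ftC)// ler_norm.
have mf y : measurable_fun A (fun t => f t y).
  apply: (@measurable_funS _ _ _ _ setT) => //.
  apply: (frame_measurable_real frame (Psi := fun p => J y p.2)) => p.
  by apply: (@continuous_comp _ _ _ snd (J y)); [exact: cvg_snd|exact: dual_continuous].
have xopen U : open U -> measurable (x @^-1` U).
  move=> oU; apply: (@frame_measurable_preimage _ _ _ _ _ _ _ frame _ fst) => // p.
  exact: cvg_fst.
apply: approx_representable => e e0.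
(* [K] absorbs the factors [|phi|] and [|C|] of the final estimate. *)
pose K := `|phi| * `|C| + 1.
have K0 : 0 < K by rewrite ltr_wpDl// mulr_ge0.
have [N [S [a [mS SP]]]] := weighted_step_approximation sepX mA Afin xopen
  (normr_ge0 C) xC (divr_gt0 e0 K0).
have iS k y : mu.-integrable A (EFin \o (fun t => f t y * \1_(S k) t)).
  apply: measurable_bounded_integrable => //.
    by apply: measurable_funM => //; exact: measurable_indic.
  exists (`|C| * `|y|); rewrite num_real; split=> // r /ltW Kr t At /=.
  apply: le_trans Kr; rewrite normrM -[leRHS]mulr1 ler_pM// ?fC//.
  by rewrite indicE ger0_norm//; case: (_ \in _).
have /choice[b bP] k : exists b : dual X,
    forall y, b y = \int[mu]_(t in A) (f t y * \1_(S k) t).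
  apply: (dual_of_bounded (C := `|C| * fine (mu A))) => [c y z|y].
    rewrite /GRing.scale /= -RintegralZl// -RintegralD//; last exact: integrable_mull.
    by apply: eq_Rintegral => t _; rewrite linearP mulrDl mulrA.
  rewrite (le_trans (le_normr_Rintegral _ (iS k y)))// mulrAC -Rintegral_cst//.
  apply: le_Rintegral => //; [exact: integrable_normr|exact: integrable_cst|].
  move=> t At; rewrite normrM -[leRHS]mulr1 ler_pM// ?fC//.
  by rewrite indicE ger0_norm//; case: (_ \in _).
exists (\sum_(k < N) phi (b k) *: a k) => g.
have -> : phi (adj A g) - g (\sum_(k < N) phi (b k) *: a k) =
    phi (adj A g - \sum_(k < N) g (a k) *: b k).
  rewrite [RHS]linearB; congr (_ - _); rewrite !linear_sum.
  by apply: eq_bigr => k _; rewrite !linearZ; exact: mulrC.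
have nb : `|adj A g - \sum_(k < N) g (a k) *: b k| <= `|C| * `|g| * (e / K).
  apply: dual_norm_leP => [|y]; first by rewrite mulr_ge0 ?(ltW (divr_gt0 e0 K0))// mulr_ge0.
  have -> : (adj A g - \sum_(k < N) g (a k) *: b k) y =
      adj A g y - (\sum_(k < N) g (a k) *: b k) y by [].
  rewrite dual_sumE frame_adjointE//.
  have -> : \sum_(k < N) (g (a k) *: b k) y =
      \sum_(k < N) \int[mu]_(t in A) (f t y * \1_(S k) t) * g (a k).
    by apply: eq_bigr => k _; rewrite -bP mulrC.
  have := SP (f^~ y) (`|C| * `|y|) g; rewrite mulr_ge0// => /(_ isT (mf y)).
  move=> /(_ (fun t => @fC t y))/le_trans; apply.
  by rewrite le_eqVlt; apply/orP; left; apply/eqP; ring.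
rewrite (le_trans (dual_apply_le _ _))// (le_trans (ler_wpM2l _ nb))//.
have -> : `|phi| * (`|C| * `|g| * (e / K)) = e * `|g| * ((`|phi| * `|C|) / K) by ring.
by rewrite ler_piMr ?(mulr_ge0 (ltW e0))// ler_pdivrMr// mul1r lerDl.
Qed.

Lemma tail_adjointE A g : measurable A ->
  tail_adjoint mu x f A g = (g - adj A g : dual X) :> (X -> R^o).
Proof.
move=> mA; apply/funext => y; rewrite /tail_adjoint /= coef_tail_operator//.
rewrite -setTD Rintegral_setD//; last exact: integrable_coef.
by rewrite -coef_reconstruction// -frame_adjointE.
Qed.

Lemma shrinkingP : shrinking mu x f <-> forall g e, 0 < e ->
  exists2 E0, D E0 & forall A, D A -> E0 `<=` A -> `|g - adj A g| <= e.
Proof.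
have opE g A : D A -> opnorm (tail_adjoint mu x f A g) = (`|g - adj A g|)%:E.
  move=> [mA _ _]; rewrite tail_adjointE//.
  by rewrite -[LHS]fineK//; exact: opnorm_fin.
split=> [sh g e e0|H g].
  have /fine_cvgP[_ /cvgrPdist_le/(_ _ e0)[E0 dE0 E0P]] := sh g.
  exists E0 => // A dA EA; have := E0P A (conj dA EA).
  by rewrite /= opE//= sub0r normrN normr_id.
apply/fine_cvgP; split.
  by exists set0 => [|A [dA _]]; [exact: frame_dir0|rewrite /= opE].
apply/cvgrPdist_le => e e0; have [E0 dE0 E0P] := H g e e0.
exists E0 => // A [dA EA] /=.
by rewrite opE//= sub0r normrN normr_id E0P.
Qed.

(** The point [z n] represents [P_(E n)^{**} phi]. It is a sequence, not a net, so that dominated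
    convergence can be applied to it; boundedness comes from weak convergence of scalars by uniform
    boundedness. *)
Lemma weak_star_sequence phi : shrinking mu x f ->
  exists (z : nat -> X) (B : R), (forall n, `|z n| <= B) /\
    forall g : dual X, (g (z n) : R) @[n --> \oo] --> phi g.
Proof.
move=> /shrinkingP sh; have [E [dE ndE ET EC]] := frame_exhaustion frame.
have mE n := frame_dir_measurable (dE n).
have /choice[z zP] n : exists z : X, forall g : dual X, g z = phi (adj (E n) g).
  by have [C nC] := EC n; exact: adjoint_bidual_representable nC.
(* The sets [E n] need not be cofinal in the directed set. Shrinkingness is used at [E n] united
   with [E0], and the correction lives on [E0] minus [E n], whose measure tends to 0 and where the
   frame norms are bounded. *)
have adjE g e : 0 < e -> \forall n \near \oo, `|g - adj (E n) g| <= e.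
  move=> e0; have e2 : 0 < e / 2 by rewrite divr_gt0.
  have [E0 dE0 E0P] := sh g _ e2.
  have [C C0 EC0] := frame_dir_bound dE0; have [mE0 E0fin _] := dE0.
  pose K := `|g| * C + 1.
  have K0 : 0 < K by rewrite ltr_wpDl// mulr_ge0.
  have := mu_exhaust mE0 E0fin mE ndE ET (divr_gt0 e2 K0).
  apply: filterS => n En.
  have dU := frame_dirU (dE n) dE0; have mU := frame_dir_measurable dU.
  have -> : g - adj (E n) g =
      (g - adj (E n `|` E0) g) + (adj (E n `|` E0) g - adj (E n) g).
    by rewrite addrA subrK.
  rewrite (le_trans (ler_normD _ _))// (splitr e) lerD//.
    by apply: E0P => // t; right.
  apply: dual_norm_leP => [|y]; first exact: ltW.
  have -> : (adj (E n `|` E0) g - adj (E n) g) y =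
      adj (E n `|` E0) g y - adj (E n) g y by [].
  rewrite !frame_adjointE// -Rintegral_setD//; last exact: integrable_coef.
  rewrite setDUl setDv set0U.
  have dD : D (E0 `\` E n).
    by apply: frame_dirS dE0 => [|t []//]; exact: measurableD.
  have DC t : (E0 `\` E n) t -> `|f t| * `|x t| <= C by move=> [/EC0].
  rewrite (le_trans (Rintegral_coef_dir_le frame (J y) g dD DC))//.
  apply: (@le_trans _ _ (`|y| * `|g| * C * (e / 2 / K))).
    by rewrite ler_pM ?fine_ge0 ?mulr_ge0 ?mulr_ge0// ler_wpM2r// ler_wpM2r// norm_bidual_le.
  have -> : `|y| * `|g| * C * (e / 2 / K) = (e / 2 * `|y|) * ((`|g| * C) / K) by ring.
  by rewrite ler_piMr ?(mulr_ge0 (ltW e2))// ler_pdivrMr// mul1r lerDl.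
have zphi (g : dual X) : (g (z n) : R) @[n --> \oo] --> phi g.
  apply/cvgrPdist_le => e e0.
  have K0 : 0 < `|phi| + 1 by rewrite ltr_wpDl.
  apply: filterS (adjE g _ (divr_gt0 e0 K0)) => n En; rewrite zP.
  have -> : phi g - phi (adj (E n) g) = phi (g - adj (E n) g) by rewrite linearB.
  rewrite (le_trans (dual_apply_le _ _))// (le_trans (ler_wpM2l _ En))//.
  by rewrite mulrCA ler_piMr ?(ltW e0)// ler_pdivrMr// mul1r lerDl.
have [|B B0 zB] := @weakly_bounded_bounded _ _ _ z.
  move=> g; have /cvg_seq_bounded : cvgn (fun n => g (z n)) by apply/cvg_ex; exists (phi g).
  move=> /pinfty_ex_gt0[C _ gC]; exists C => n; exact: gC.
by exists z, B.
Qed.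

(** For [phi] replaced by [z n] this is the definition of [P_A^*]. Both sides pass to the limit: the
    right one by weak-star convergence, the left one because [f_t(z n)] tends to [phi(f_t)] for each
    [t], under the constant bound [B * |g| * C] on [A]. *)
Lemma Rintegral_coef_adjoint phi g A : shrinking mu x f -> D A ->
  \int[mu]_(t in A) coef phi g t = phi (adj A g).
Proof.
move=> sh dA; have [z [B [zB zphi]]] := weak_star_sequence phi sh.
have [C C0 AC] := frame_dir_bound dA; have [mA Afin _] := dA.
apply: (@cvg_unique _ (@Rhausdorff R) ((adj A g (z n) : R) @[n --> \oo])); last exact: zphi.
have -> : (fun n => adj A g (z n)) = (fun n => \int[mu]_(t in A) coef (J (z n)) g t).
  by apply/funext => n; rewrite frame_adjointE.
have bd n t : A t -> `|coef (J (z n)) g t| <= B * `|g| * C.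
  move=> At; rewrite (le_trans (frame_coef_le _ _ _ _ _))//.
  rewrite ler_pM ?mulr_ge0 ?AC// ler_wpM2r//.
  by rewrite (le_trans (norm_bidual_le _)).
have [|||||_ _ cv] := @dominated_convergence _ _ _ mu A mA
  (fun n => EFin \o coef (J (z n)) g) (EFin \o coef phi g) (EFin \o (fun=> B * `|g| * C)).
- by move=> n; apply/measurable_EFinP; exact: (measurable_frame_coef frame).
- by apply/measurable_EFinP; exact: (measurable_frame_coef frame).
- apply: aeW => t At; apply: cvg_EFin; first exact: nearW.
  by apply: cvgMr_tmp; exact: zphi.
- exact: integrable_cst.
- by apply: aeW => t n At; rewrite lee_fin; exact: bd.
have /fine_cvgP[_ +] : (\int[mu]_(t in A) (EFin \o coef (J (z n)) g) t)%E @[n --> \oo] -->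
    (\int[mu]_(t in A) coef phi g t)%:E.
  rewrite /Rintegral fineK; first exact: cv.
  exact: (integrable_fin_num mA (integrable_coef_dir frame phi g dA)).
by [].
Qed.

Lemma coef_norm_dir_bound phi g : shrinking mu x f ->
  exists2 C, 0 <= C & forall A, D A -> \int[mu]_(t in A) `|coef phi g t| <= C.
Proof.
move=> sh; have [C C0 gC] := frame_adjoint_norm g.
exists (2 * (`|phi| * C)) => [|A dA]; first by rewrite !mulr_ge0.
have mA := frame_dir_measurable dA.
apply: Rintegral_normr_le => //; first exact: integrable_coef_dir.
move=> B mB BA; rewrite Rintegral_coef_adjoint//; last exact: frame_dirS dA.
by rewrite (le_trans (dual_apply_le _ _))// ler_wpM2l// gC.
Qed.

(** The gliding hump: choosing successors repeatedly, from the empty set on, gives an increasing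
    chain in the directed set with disjoint increments. *)
Lemma frame_chain (P : set M -> set M -> Prop) :
  (forall E0, D E0 -> exists A, [/\ D A, E0 `<=` A & P E0 A]) ->
  exists K : nat -> set M, [/\ forall n, D (K n), forall n, P (K n) (K n.+1),
    forall n, K n `<=` K n.+1 & trivIset setT (fun n => K n.+1 `\` K n)].
Proof.
move=> H; have /choice[next nextP] (E0 : {A | D A}) : exists A : {A | D A},
    sval E0 `<=` sval A /\ P (sval E0) (sval A).
  by have [A [dA EA PA]] := H _ (svalP E0); exists (exist _ A dA).
pose K n := iter n next (exist _ set0 (frame_dir0 mu x f)).
have KS n : sval (K n) `<=` sval (K n.+1) by exact: (nextP (K n)).1.
have Kle m n : (m <= n)%N -> sval (K m) `<=` sval (K n).
  by move/subnK <-; elim: (n - m)%N => // k IH t /IH /KS.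
exists (fun n => sval (K n)); split => //.
- by move=> n; exact: svalP.
- by move=> n; exact: (nextP (K n)).2.
- have dis m n : (m < n)%N -> ~ ((sval (K m.+1) `\` sval (K m)) `&` (sval (K n.+1) `\` sval (K n)) !=set0).
    by move=> mn [t [[Km _] [_]]]; apply; exact: (Kle _ _ mn).
  move=> m n _ _ mn; apply: contrapT => /eqP; rewrite neq_ltn => /orP[] h.
    exact: dis h mn.
  by apply: dis h _; rewrite setIC.
Qed.

(** The seminorms are the L1 norms of [f_t(.) g(x_t)] on the disjoint increments; disjointness
    bounds their sum by [C * |u|]. *)
Lemma no_l1_shrinking : ~ contains_copy X (l1 R) -> shrinking mu x f.
Proof.
move=> nl1; apply/shrinkingP => g e e0; apply: contrapT => nsh; apply: nl1.
have [E [dE ndE ET _]] := frame_exhaustion frame.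
have mE n := frame_dir_measurable (dE n).
pose P E0 A := exists2 y, `|y| <= 1 & e <= \int[mu]_(t in A `\` E0) `|coef (J y) g t|.
have ic A y : measurable A -> mu.-integrable A (EFin \o (fun t => `|coef (J y) g t|)).
  by move=> mA; apply: integrable_normr => //; exact: integrable_coef.
have [E0 dE0|K [dK PK KS tK]] := @frame_chain P.
  have [A [dA EA gA]] : exists A, [/\ D A, E0 `<=` A & e < `|g - adj A g|].
    apply: contrapT => h; apply: nsh; exists E0 => // A dA EA.
    by rewrite leNgt; apply/negP => gA; apply: h; exists A.
  have mA := frame_dir_measurable dA; have mE0 := frame_dir_measurable dE0.
  have [y y1 gy] : exists2 y, `|y| <= 1 & e < `|(g - adj A g) y|.
    apply: contrapT => h; move: gA; apply/negP; rewrite -leNgt.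
    apply: dual_norm_le => y y1; rewrite leNgt; apply/negP => gy.
    by apply: h; exists y.
  have mC := measurableC mA.
  have {gy} : e < \int[mu]_(t in ~` A) `|coef (J y) g t|.
    apply: lt_le_trans gy _; rewrite -tail_adjointE// /tail_adjoint /= coef_tail_operator//.
    by apply: le_normr_Rintegral => //; exact: integrable_coef.
  (* The tail outside [A] may have infinite measure. As the sets [E n] exhaust [M], a part inside
     some [E n] already carries more than [e], and [A] united with [E n] is the next set of the
     chain. *)
  have [[n hn] _|h] := pselect (exists n, e < \int[mu]_(t in ~` A `&` E n) `|coef (J y) g t|).
    exists (A `|` E n); split; [exact: frame_dirU|by move=> t /EA; left|].
    exists y => //; rewrite (le_trans (ltW hn))// le_Rintegral_subset//.
    + exact: measurableI.
    + by apply: measurableD => //; exact: measurableU.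
    + by move=> t [nAt Et]; split; [right|move=> /EA].
    + by apply: ic; apply: measurableD => //; exact: measurableU.
  rewrite ltNge => /negP; case; apply: (@Rintegral_exhaust_le _ _ _ mu E) => //.
    exact: ic.
  by move=> n; rewrite leNgt; apply/negP => hn; apply: h; exists n.
have mF n : measurable (K n.+1 `\` K n).
  by apply: measurableD; exact: frame_dir_measurable.
have /choice[y yP] n : exists y, `|y| <= 1 /\
    e <= \int[mu]_(t in K n.+1 `\` K n) `|coef (J y) g t|.
  by have [y y1 ey] := PK n; exists y.
have [C C0 gC] := coef_norm_bound frame g.
apply: (@contains_l1_of_seminorms _ _
  (fun n y => \int[mu]_(t in K n.+1 `\` K n) `|coef (J y) g t|) y C e) => //.
- move=> k u v; rewrite -RintegralD//; [|exact: ic..].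
  apply: le_Rintegral => //; first exact: ic.
    exact: (integrableD (mF k) (ic _ u (mF k)) (ic _ v (mF k))).
  by move=> t _; rewrite frame_coefD ler_normD.
- move=> k a u; rewrite -RintegralZl//; last exact: ic.
  by apply: eq_Rintegral => t _; rewrite frame_coefZ normrM.
- move=> u r ur.
  have mU : measurable (\big[setU/set0]_(k <- r) (K k.+1 `\` K k)).
    by apply: bigsetU_measurable => k _; exact: mF.
  rewrite (sum_Rintegral_disjoint mF tK ur); last exact: ic.
  exact: Rintegral_normr_coef_le.
- by move=> n; exact: (yP n).1.
- by move=> n; exact: (yP n).2.
Qed.

(** Shrinkingness supplies, for each [g], an L1 bound for [phi(f_t) g(x_t)] uniform over the
    directed set. It makes the increments of the net along a chain weakly unconditionally Cauchy. *)
Lemma no_c0_boundedly_complete : shrinking mu x f -> ~ contains_copy X (c0 R) ->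
  boundedly_complete mu x f.
Proof.
move=> sh nc0 phi; pose I A := pettis_integral mu A (fun t => phi (f t) *: x t).
have gI g A : D A -> g (I A) = \int[mu]_(t in A) coef phi g t.
  by move=> dA; have [_] := pettis_coef g (pettis_integral_dir sepX frame phi dA).
apply: cauchy_cvg; apply/cauchyP => e e0; apply: contrapT => nC; apply: nc0.
pose P E0 A := e <= `|I A - I E0|.
have [E0 dE0|K [dK PK KS tK]] := @frame_chain P.
  (* If no successor of [E0] moved the integral by [e], then [I E0] would be a centre for the Cauchy
     condition at [e]. *)
  apply: contrapT => h; apply: nC; exists (I E0); exists E0 => // A [dA EA] /=.
  rewrite -ball_normE /= ltNge; apply/negP => IA; apply: h; exists A; split=> //.
  by rewrite /P distrC.
have mK n := frame_dir_measurable (dK n).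
have mF n : measurable (K n.+1 `\` K n) by exact: measurableD.
have dF n : D (K n.+1 `\` K n) by apply: frame_dirS (dK n.+1) => // t [].
apply: (@contains_c0_of_wuc _ _ (fun n => I (K n.+1) - I (K n)) e) => // g.
have [C C0 gC] := coef_norm_dir_bound phi g sh; exists C => r ur.
have dU : D (\big[setU/set0]_(k <- r) (K k.+1 `\` K k)).
  by elim/big_ind : _ => [|A B dA dB|k _]; [exact: frame_dir0|exact: frame_dirU|].
have mU := frame_dir_measurable dU.
apply: le_trans (gC _ dU).
rewrite -(sum_Rintegral_disjoint mF tK ur); last first.
  by apply: integrable_normr => //; exact: integrable_coef_dir.
apply: ler_sum => k _; have ik := integrable_coef_dir frame phi g (dF k).
rewrite linearB /= !gI// -Rintegral_setD//; first exact: le_normr_Rintegral.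
exact: integrable_coef_dir.
Qed.

(** The norm limit [y] of the net represents [phi]: tested on [g], the net equals [phi(P_A^* g)],
    which tends to [phi g] because [P_A^* g] tends to [g]. *)
Lemma shrinking_boundedly_complete_reflexive :
  shrinking mu x f -> boundedly_complete mu x f -> reflexive_space X.
Proof.
move=> sh bc; apply/seteqP; split => // phi _.
pose I A := pettis_integral mu A (fun t => phi (f t) *: x t).
have /cvg_ex[y yP] := bc phi; exists y => //.
have netP : ProperFilter net by exact: frame_net_filter.
apply/val_inj/funext => g.
have gy := @dual_cvg _ _ _ _ (@filter_filter _ _ netP) g _ _ yP.
suff gphi : g (I A) @[A --> net] --> (phi g : R).
  exact: (@cvg_unique _ (@Rhausdorff R) _ _ (g y) (phi g) gy gphi).
apply/cvgrPdist_le => e e0.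
have K0 : 0 < `|phi| + 1 by rewrite ltr_wpDl.
have [E0 dE0 EP] := (shrinkingP.1 sh) g _ (divr_gt0 e0 K0).
exists E0 => // A [dA EA] /=.
have [_ ->] := pettis_coef g (pettis_integral_dir sepX frame phi dA).
rewrite -/(frame_coef x f phi g) Rintegral_coef_adjoint//.
have -> : phi g - phi (adj A g) = phi (g - adj A g) by rewrite linearB.
rewrite (le_trans (dual_apply_le _ _))// (le_trans (ler_wpM2l _ (EP A dA EA)))//.
by rewrite mulrCA ler_piMr ?(ltW e0)// ler_pdivrMr// mul1r lerDl.
Qed.

End FrameDuality.

(** * The three equivalent conditions *)

Theorem theorem3p10 (R : realType) (X : completeNormedModType R)
    (d : measure_display) (M : measurableType d)
    (mu : {sigma_finite_measure set M -> \bar R})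
    (x : M -> X) (f : M -> dual X)
    (sepX : separable_space X)
    (frame : continuous_schauder_frame mu x f) :
  ((shrinking mu x f /\ boundedly_complete mu x f) <->
   (~ contains_copy X (c0 R) /\ ~ contains_copy X (l1 R))) /\
  ((~ contains_copy X (c0 R) /\ ~ contains_copy X (l1 R)) <->
   reflexive_space X).
Proof.
(* The implications form a cycle from (2) to (1) to (3) and back to (2). Shrinkingness comes first,
   as bounded completeness is derived from it. *)
have two_one : ~ contains_copy X (c0 R) /\ ~ contains_copy X (l1 R) ->
    shrinking mu x f /\ boundedly_complete mu x f.
  move=> [nc0 nl1]; have sh := no_l1_shrinking frame nl1.
  by split => //; exact: no_c0_boundedly_complete.
have one_three : shrinking mu x f /\ boundedly_complete mu x f -> reflexive_space X.
  by move=> [sh bc]; exact: (shrinking_boundedly_complete_reflexive sepX frame).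
have three_two : reflexive_space X ->
    ~ contains_copy X (c0 R) /\ ~ contains_copy X (l1 R).
  by move=> rX; split; [exact: reflexive_no_c0|exact: reflexive_no_l1].
split; first by split=> [/one_three/three_two|/two_one].
by split=> [/two_one/one_three|/three_two].
Qed.
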